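(* Let $T\ge 1$ be an integer. Consider a finite state Markov channel with input alphabet $\mathcal{X}$, output alphabet $\mathcal{Y}$, state alphabet $\mathcal{U}$, transition law $p(y|x,u)$ and state process $(U_n)_{n\ge1}$, with the states perfectly known at the receiver and with periodic noiseless feedback of the states $U_1, U_{T+1}, U_{2T+1},\dots$ to the transmitter (period $T$), as specified in the context. Then the capacity of this channel is $$C=\frac{1}{T}\sum_{t=1}^{T}\ \sum_{v\in\mathcal{U}}\Pr(v)\ \max_{q_t(\cdot|v)}\ \sum_{u\in\mathcal{U}}P_t(u|v)\, I(X;Y|u,v),$$ where $\Pr(v)=\Pr(V_i=v)$ is the distribution of the fed-back state, $P_t(u|v)=\Pr(U_i=u\mid U_{i-t+1}=v)$, and for each $t$ and $v$ the maximum is over all probability distributions $q_t(\cdot|v)$ on $\mathcal{X}$. Here $I(X;Y|u,v)$ denotes the mutual information between $X$ and $Y$ when $X$ has distribution $q_t(\cdot|v)$ and, given $X=x$, $Y$ has distribution $p(\cdot|x,u)$.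
   Context: Channel model. The alphabets $\mathcal{X},\mathcal{Y},\mathcal{U}$ are finite. At each time $n=1,2,\dots$ the channel has input $X_n\in\mathcal{X}$, output $Y_n\in\mathcal{Y}$ and state $U_n\in\mathcal{U}$. The state process is a first-order Markov process: $\Pr(u_n|u_1^{n-k})=\Pr(u_n|u_{n-k})$ for $1\le k<n$, where $a_m^n=(a_m,\dots,a_n)$. It evolves independently of the message and of the channel inputs and outputs (it is not affected by them). Given the states, the channel is memoryless: given the message, $U_1^N$, the inputs up to time $n$ and the outputs before time $n$, the output $Y_n$ has distribution $p(\cdot|X_n,U_n)$. Feedback. With period $T$, the block length is $N=MT$ with $M$ a positive integer. Put $V_i=U_{T(i-1)+1}$ for $1\le i\le M$, and for each time $n$ let $\tilde n=\lfloor (n-1)/T\rfloor+1$ be the index of the length-$T$ block containing $n$. The state $V_i$ is received by the transmitter, without error or delay, at time $T(i-1)+1$. Standing assumption. For each $1\le t\le T$, the processes $(U_{(i-1)T+t})_{i\ge1}$ and $(V_i)_{i\ge 1}$ are jointly stationary and ergodic. The state process is stationary, so $\Pr(V_i=v)$ and $P_t(u|v)=\Pr(U_i=u|U_{i-t+1}=v)$ do not depend on $i$. Terms with $\Pr(v)=0$ are omitted from the sum. Codes and capacity. A code of length $N$ and rate $R$ consists of a message set $\mathcal{W}$ of cardinality $2^{NR}$, encoding functions $\varphi_n$, $1\le n\le N$, producing $x_n=\varphi_n(w,v_1^{\tilde n})\in\mathcal{X}$, and a decoding function $\phi$ producing $\hat w=\phi(y_1^N,u_1^N)\in\mathcal{W}$.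 The message $W$ is uniform on $\mathcal{W}$ and independent of the state process. The error probability is $P_e=\Pr(\hat W\ne W)$. A rate $R$ is achievable if there are codes of length $N=MT$ and rate at least $R-o(1)$ with $P_e\to0$ as $M\to\infty$ (cardinalities rounded to integers as needed). The capacity is the supremum of achievable rates. Mutual information is in bits (logarithms to base 2). *)

(* Defs.v *)
From mathcomp Require Import all_boot all_order all_algebra.
From mathcomp Require Import all_classical all_reals all_analysis.

Set Implicit Arguments.
Unset Strict Implicit.
Unset Printing Implicit Defensive.

Import Order.TTheory GRing.Theory Num.Theory.
Import numFieldNormedType.Exports.

Local Open Scope classical_set_scope.
Local Open Scope ring_scope.

(* Time, blocks and positions inside a block are all counted from 0: the     *)
(* channel use written n in a 1-based convention is n - 1 here.              *)

Section FiniteProbability.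
Variable R : realType.

Definition is_pmf (A : finType) (q : A -> R) : Prop :=
  (forall a, 0 <= q a) /\ \sum_a q a = 1.

Definition log2 (x : R) : R := ln x / ln 2.

(* The terms with J a b = 0 vanish, whatever the value of the logarithm. *)
Definition mutual_information (A B : finType) (J : A -> B -> R) : R :=
  \sum_a \sum_b
    J a b * log2 (J a b / ((\sum_b' J a b') * (\sum_a' J a' b))).

(* I(X;Y) when X has law q and, given X = x, Y has law W x. *)
Definition channel_information (A B : finType) (q : A -> R) (W : A -> B -> R)
    : R :=
  mutual_information (fun a b => q a * W a b).

End FiniteProbability.

Section Processes.
Context {R : realType} {d : measure_display} {Om : measurableType d}.
Variable P : probability Om R.

Definition Pr (E : set Om) : R := fine (P E).

Definition cPr (E F : set Om) : R := Pr (E `&` F) / Pr F.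

Section Process.
Variables (A : Type) (Z : nat -> Om -> A).

Definition is_process : Prop :=
  forall n a, measurable [set w | Z n w = a].

Definition stationary : Prop :=
  forall (k n : nat) (z : nat -> A),
    Pr [set w | forall i, (i < n)%N -> Z (k + i)%N w = z i] =
    Pr [set w | forall i, (i < n)%N -> Z i w = z i].

(* The conditional law of the present given the past up to k steps ago       *)
(* depends on the last observed value only.                                  *)
Definition markov_process : Prop :=
  forall (m k : nat) (z : nat -> A) (a : A), (0 < k)%N ->
    let past := [set w | forall i, (i <= m)%N -> Z i w = z i] in
    0 < Pr past ->
    cPr [set w | Z (m + k)%N w = a] past =
    cPr [set w | Z (m + k)%N w = a] [set w | Z m w = z m].

Definition cylinders : set (set (nat -> A)) :=
  [set B | exists i a, B = [set s | s i = a]].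

Definition shift_seq (s : nat -> A) : nat -> A := fun i => s i.+1.

(* Every shift-invariant event of the path space (with its product           *)
(* sigma-algebra; A is meant to be finite) is trivial.                       *)
Definition ergodic : Prop :=
  forall B : set (nat -> A), <<s cylinders >> B -> shift_seq @^-1` B = B ->
    Pr [set w | B (fun i => Z i w)] = 0 \/ Pr [set w | B (fun i => Z i w)] = 1.

End Process.

End Processes.

Section Feedback.
Variables (U : finType) (T M : nat).

Lemma feedback_time_lt (n : 'I_(M * T)) (j : 'I_(n %/ T).+1) :
  (T * j < M * T)%N.
Proof.
apply: leq_ltn_trans (ltn_ord n); rewrite mulnC.
by apply: leq_trans (leq_divM n T); rewrite leq_mul2r -ltnS ltn_ord orbT.
Qed.

(* The states U_0, U_T, ..., U_{T (n %/ T)} fed back up to time n. *)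
Definition fed_back (u : {ffun 'I_(M * T) -> U}) (n : 'I_(M * T)) :
    {ffun 'I_(n %/ T).+1 -> U} :=
  [ffun j => u (Ordinal (feedback_time_lt j))].

End Feedback.

(* Codes of length M * T.  The type of [enc] makes the encoder causal: at    *)
(* time n it sees the message and the states fed back up to time n.          *)
Record code (X Y U : finType) (T M : nat) := Code {
  msg : finType;
  enc : forall n : 'I_(M * T), msg -> {ffun 'I_(n %/ T).+1 -> U} -> X;
  dec : {ffun 'I_(M * T) -> Y} -> {ffun 'I_(M * T) -> U} -> msg
}.

Section Channel.
Context {R : realType} {d : measure_display} {Om : measurableType d}.
Variables (X Y U : finType).
Variables (p : X -> U -> Y -> R) (P : probability Om R) (S : nat -> Om -> U).
Variable T : nat.

Definition rate M (c : code X Y U T M) : R :=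
  log2 #|msg c|%:R / (M * T)%:R.

Definition state_law N (u : {ffun 'I_N -> U}) : R :=
  Pr P [set w | forall i : 'I_N, S i w = u i].

Definition channel_input M (c : code X Y U T M) (m : msg c)
    (u : {ffun 'I_(M * T) -> U}) (n : 'I_(M * T)) : X :=
  enc m (fed_back u n).

(* Joint law of the message, the states and the outputs: the message is      *)
(* uniform and independent of the states (lemma joint_law_msg_state) and the *)
(* channel is memoryless given the states (lemma joint_law_memoryless).      *)
Definition joint_law M (c : code X Y U T M) (m : msg c)
    (u : {ffun 'I_(M * T) -> U}) (y : {ffun 'I_(M * T) -> Y}) : R :=
  #|msg c|%:R^-1 * state_law u *
  \prod_(n < M * T) p (channel_input m u n) (u n) (y n).

Definition error_probability M (c : code X Y U T M) : R :=
  \sum_(m : msg c) \sum_u \sum_(y | dec c y u != m) joint_law m u y.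

Definition achievable (r : R) : Prop :=
  exists (c : forall M, code X Y U T M) (eps : nat -> R),
    [/\ eps @ \oo --> 0,
        (forall M, (0 < M)%N -> r - eps M <= rate (c M)) &
        (fun M => error_probability (c M)) @ \oo --> 0].

Definition capacity : \bar R := ereal_sup [set r%:E | r in achievable].

Definition feedback_prob (v : U) : R := Pr P [set w | S 0%N w = v].

(* The conditional probability that the state is u, given that it was v t    *)
(* steps earlier (this is P_{t+1}(u|v) when t is counted from 1).            *)
Definition state_trans (t : nat) (u v : U) : R :=
  cPr P [set w | S t w = u] [set w | S 0%N w = v].

Definition sampled_pair (t i : nat) (w : Om) : U * U :=
  (S (T * i + t)%N w, S (T * i)%N w).

Definition averaged_information (t : nat) (v : U) (q : X -> R) : R :=
  \sum_u state_trans t u v * channel_information q (fun x y => p x u y).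

Section JointLaw.
Hypothesis p_pmf : forall x u, is_pmf (p x u).
Variables (M : nat) (c : code X Y U T M) (m : msg c).
Variable u : {ffun 'I_(M * T) -> U}.

Lemma joint_law_prefix (k : nat) (y : {ffun 'I_(M * T) -> Y}) :
  \sum_(y' : {ffun 'I_(M * T) -> Y} |
        [forall i : 'I_(M * T), (i < k)%N ==> (y' i == y i)]) joint_law m u y' =
  #|msg c|%:R^-1 * state_law u *
  \prod_(n < M * T | (n < k)%N) p (channel_input m u n) (u n) (y n).
Proof.
rewrite /joint_law -big_distrr /=; congr (_ * _).
pose F (i : 'I_(M * T)) : pred Y := fun b => (i < k)%N ==> (b == y i).
have -> : \sum_(y' : {ffun 'I_(M * T) -> Y} |
        [forall i : 'I_(M * T), (i < k)%N ==> (y' i == y i)])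
      \prod_(n < M * T) p (channel_input m u n) (u n) (y' n) =
    \prod_(n < M * T) \sum_(b | F n b) p (channel_input m u n) (u n) b.
  by rewrite bigA_distr_big_dep; apply: eq_bigl => y'; apply/forallP/familyP.
rewrite [RHS]big_mkcond; apply: eq_bigr => n _; rewrite /F.
case: ltnP => _ /=; first by rewrite big_pred1_eq.
exact: (p_pmf _ _).2.
Qed.

Lemma joint_law_msg_state :
  \sum_y joint_law m u y = #|msg c|%:R^-1 * state_law u.
Proof.
rewrite /joint_law -big_distrr /= -[RHS]mulr1; congr (_ * _).
by rewrite -(bigA_distr_bigA (fun n => p (channel_input m u n) (u n))) big1 //=
   => n _; exact: (p_pmf _ _).2.
Qed.

Lemma joint_law_memoryless (n : 'I_(M * T)) (y : {ffun 'I_(M * T) -> Y}) :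
  let prefix_prob k := \sum_(y' : {ffun 'I_(M * T) -> Y} |
    [forall i : 'I_(M * T), (i < k)%N ==> (y' i == y i)]) joint_law m u y' in
  prefix_prob n.+1 = prefix_prob n * p (channel_input m u n) (u n) (y n).
Proof.
rewrite /= !joint_law_prefix -[RHS]mulrA; congr (_ * _).
rewrite (bigD1 n) ?ltnS//= [RHS]mulrC; congr (_ * _); apply: eq_bigl => i.
by rewrite ltnS ltn_neqAle andbC.
Qed.

End JointLaw.

End Channel.

(* Main.v *)
(* Converse.  For a code with L messages, the joint law of the message, the   *)
(* states and the outputs is compared with the law that keeps the states and  *)
(* draws the outputs, given the states, from the product of the single-letter *)
(* output laws, independently of the message.  The divergence between the two *)
(* is a sum of single-letter informations; decoding succeeds with probability *)
(* 1/L under the second law, so the divergence is at least                    *)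
(* (1 - Pe) log L - 1.  The law of the n-th input only depends on the states  *)
(* fed back up to time n, so that by the Markov property the information at   *)
(* time n is at most the maximal averaged information given the last of them. *)
(*                                                                            *)
(* Achievability.  A codeword assigns a letter to every time and every value  *)
(* of the last fed-back state, drawn from the optimal law for that state.     *)
(* Feinstein's lemma reduces the claim to the concentration of the            *)
(* information density.  Given the states it is a sum of independent terms,   *)
(* so its fluctuations are controlled by Chebyshev's inequality.  Its         *)
(* conditional mean is an additive functional of the states, which            *)
(* concentrates because ergodicity makes the harmonic functions of the        *)
(* fed-back chain constant: the Poisson equation is then solvable, and the    *)
(* functional is a martingale with bounded increments up to a bounded error.  *)

Require Import Defs.
From mathcomp Require Import all_boot all_order all_algebra.
From mathcomp Require Import all_classical all_reals all_analysis.
From mathcomp Require Import ring lra.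

Set Implicit Arguments.
Unset Strict Implicit.
Unset Printing Implicit Defensive.

Import Order.TTheory GRing.Theory Num.Theory.
Import numFieldNormedType.Exports.
Local Open Scope ring_scope.

(** * Product laws, Feinstein's lemma and divergence *)

(** At each time the feedback tells the transmitter about the current state only through the last
    fed-back state v and the time t elapsed since then: by the Markov property older feedback adds
    nothing, and nothing new arrives inside a block. The receiver knows the states, so each use of
    the channel is worth at most the information averaged over the conditional law of the current
    state given v, maximized over the input law. [exists_max_information] provides the maximizers.

    That no code does better is [code_rate_bound]: [success_bound] bounds the log-size of a code by
    a sum of single-letter informations with the state path fixed, and [mean_markov] then averages
    each of them over the current state. [achievable_le] divides by the block length and passes to
    the limit.

    That every smaller rate is reached is [lt_achievable]. The channel is viewed as one from
    strategies (letters indexed by time and fed-back state) to pairs of state path and output word,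
    and [feinstein] is applied to it in [random_block_code]. What remains is a second moment of
    order M for the information density. Its fluctuation given the states is handled by
    [variance_sum_prod_ffun], and the fluctuation of its conditional mean by
    [block_sum_second_moment]. The latter rests on [poisson_equation], which is solvable because
    [harmonic_constant] turns ergodicity into a bound on the kernel of a matrix.

    Expectations are mostly finite sums over state paths ([path_mean]); countable operations on
    events of the underlying space occur only in the ergodic argument. *)

Section ProductLaws.
Variables (R : realType) (I B : finType) (w : I -> B -> R).

Lemma sum_prod_ffun (f : I -> B -> R) :
  \sum_(b : {ffun I -> B}) (\prod_i w i (b i)) * \prod_i f i (b i) =
  \prod_i \sum_x w i x * f i x.
Proof.
by rewrite bigA_distr_bigA; apply: eq_bigr => b _; rewrite big_split.
Qed.

Hypothesis w1 : forall i, \sum_x w i x = 1.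

Lemma sum_prod_ffun1 i (f : B -> R) :
  \sum_(b : {ffun I -> B}) (\prod_j w j (b j)) * f (b i) =
  \sum_x w i x * f x.
Proof.
have := sum_prod_ffun (fun j x => if j == i then f x else 1).
rewrite (bigD1 i)//= eqxx [X in _ = _ * X]big1 ?mulr1 => [<-|j /negbTE ->].
  apply: eq_bigr => b _; congr (_ * _).
  by rewrite (bigD1 i)//= eqxx big1 ?mulr1// => j /negbTE ->.
by rewrite -[RHS](w1 j); apply: eq_bigr => x _; rewrite mulr1.
Qed.

Lemma sum_prod_ffun2 i k (f g : B -> R) : i != k ->
  \sum_(b : {ffun I -> B}) (\prod_j w j (b j)) * (f (b i) * g (b k)) =
  (\sum_x w i x * f x) * (\sum_x w k x * g x).
Proof.
move=> ik; have ki : (k == i) = false by rewrite eq_sym (negbTE ik).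
have := sum_prod_ffun
  (fun j x => if j == i then f x else if j == k then g x else 1).
rewrite (bigD1 i)//= (bigD1 k) ?ki//= !eqxx.
rewrite [X in _ = _ * (_ * X)]big1 ?mulr1 => [<-|j /andP[/negbTE -> /negbTE ->]].
  apply: eq_bigr => b _; congr (_ * _).
  rewrite (bigD1 i)//= eqxx (bigD1 k) ?ki//= eqxx big1 ?mulr1//.
  by move=> j /andP[/negbTE -> /negbTE ->].
by rewrite -[RHS](w1 j); apply: eq_bigr => x _; rewrite mulr1.
Qed.

(** Centered coordinates are uncorrelated under a product law, so only the diagonal terms of the
    expanded square survive. *)
Lemma variance_sum_prod_ffun (f : I -> B -> R) :
  (forall i, \sum_x w i x * f i x = 0) ->
  \sum_(b : {ffun I -> B}) (\prod_j w j (b j)) * (\sum_i f i (b i)) ^+ 2 =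
  \sum_i \sum_x w i x * f i x ^+ 2.
Proof.
move=> f0.
transitivity (\sum_i \sum_k \sum_(b : {ffun I -> B})
    (\prod_j w j (b j)) * (f i (b i) * f k (b k))).
  transitivity (\sum_(b : {ffun I -> B}) \sum_i \sum_k
    (\prod_j w j (b j)) * (f i (b i) * f k (b k))).
    apply: eq_bigr => b _; rewrite expr2 big_distrlr big_distrr/=.
    by apply: eq_bigr => i _; rewrite big_distrr.
  rewrite exchange_big/=; apply: eq_bigr => i _.
  by rewrite exchange_big.
apply: eq_bigr => i _; rewrite (bigD1 i)//= [X in _ + X]big1 ?addr0 => [|k ki].
  rewrite -(sum_prod_ffun1 i (fun x => f i x ^+ 2)).
  by apply: eq_bigr => b _; rewrite expr2.
by rewrite sum_prod_ffun2 1?eq_sym// f0 mul0r.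
Qed.

End ProductLaws.

Section Feinstein.
Variables (R : realType) (A B : finType) (Q : A -> R) (W : A -> B -> R).
Hypotheses (Qpmf : is_pmf Q) (Wpmf : forall a, is_pmf (W a)).

Let QW b := \sum_a Q a * W a b.

(* Feinstein's greedy argument: a codeword is added as long as some input    *)
(* still has enough mass on the part of its typical outputs that is not yet  *)
(* used; if none has, the used outputs have QW-measure more than L / gam,    *)
(* while each decoding set has QW-measure at most 1 / gam.                   *)
Lemma feinstein (gam : R) (L : nat) : 0 < gam ->
  exists (a : nat -> A) (dec : B -> nat), forall j, (j < L)%N ->
    \sum_(b | dec b != j) W (a j) b <=
    \sum_a \sum_(b | W a b <= gam * QW b) Q a * W a b + L%:R / gam.
Proof.
move=> gam0; set bad := \sum_a _; set eps := bad + _.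
have W0 a b : 0 <= W a b by case: (Wpmf a).
have Q0 a : 0 <= Q a by case: Qpmf.
have a0 : A.
  case: (pickP A) => [a _ //|/= A0]; case: Qpmf => _.
  by rewrite big1 => [/eqP|a]; [rewrite eq_sym oner_eq0 | have := A0 a].
suff [a [dec [H _]]] : exists (a : nat -> A) (dec : B -> nat),
  (forall j, (j < L)%N -> \sum_(b | dec b != j) W (a j) b <= eps) /\
  (forall b, (dec b < L)%N -> gam * QW b < W (a (dec b)) b) by exists a, dec.
suff: forall l, (l <= L)%N -> exists (a : nat -> A) (dec : B -> nat),
  (forall j, (j < l)%N -> \sum_(b | dec b != j) W (a j) b <= eps) /\
  (forall b, (dec b < l)%N -> gam * QW b < W (a (dec b)) b) by apply.
elim=> [_|l IH lL]; first by exists (fun=> a0), (fun=> 0%N).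
have [a [dec [Ha Hdec]]] := IH (ltnW lL).
pose used a1 b := (dec b < l)%N || (W a1 b <= gam * QW b).
have [[a1 Ha1]|none] := pselect (exists a1, \sum_(b | used a1 b) W a1 b <= eps).
  exists (fun j => if j == l then a1 else a j).
  exists (fun b => if (dec b < l)%N then dec b else
                   if gam * QW b < W a1 b then l else l.+1).
  split=> [j|b].
    rewrite ltnS leq_eqVlt => /predU1P[->|jl].
      rewrite eqxx; apply: le_trans Ha1; rewrite le_eqVlt; apply/orP; left.
      apply/eqP/eq_bigl => b; rewrite /used.
      case: ltnP => /= [bl|_]; first by rewrite (ltn_eqF bl).
      by rewrite leNgt; case: ifP; rewrite ?eqxx// => _; rewrite gtn_eqF.
    rewrite (ltn_eqF jl); apply: le_trans (Ha _ jl).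
    rewrite le_eqVlt; apply/orP; left; apply/eqP/eq_bigl => b.
    case: ltnP => //= bl; rewrite (gtn_eqF (leq_trans jl bl)).
    by case: ifP => _; rewrite gtn_eqF// ltnW.
  case: (ltnP (dec b) l) => [bl _|_]; first by rewrite (ltn_eqF bl); exact: Hdec.
  by case: ifP; rewrite ?eqxx// ltnn.
have gt a1 : eps <= \sum_(b | used a1 b) W a1 b.
  by rewrite leNgt; apply/negP => /ltW lt; apply: none; exists a1.
have: eps <= \sum_a1 Q a1 * \sum_(b | used a1 b) W a1 b.
  rewrite -[leLHS]mul1r -Qpmf.2 big_distrl/=.
  by apply: ler_sum => a1 _; exact: ler_wpM2l.
suff: \sum_a1 Q a1 * \sum_(b | used a1 b) W a1 b <= bad + l%:R / gam.
  move=> h1 h2; have := le_trans h2 h1.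
  by rewrite lerD2l ler_pM2r ?invr_gt0// ler_nat leqNgt lL.
have Hl : \sum_(b | (dec b < l)%N) QW b <= l%:R / gam.
  apply: (@le_trans _ _ (\sum_(b | (dec b < l)%N) W (a (dec b)) b / gam)).
    apply: ler_sum => b bl; rewrite ler_pdivlMr// mulrC ltW//; exact: Hdec.
  have -> : \sum_(b | (dec b < l)%N) W (a (dec b)) b / gam =
     \sum_(j < l) \sum_(b | (dec b == j)) W (a j) b / gam.
    rewrite [RHS](exchange_big_dep (fun b => dec b < l)%N)//=; last first.
      by move=> i b _ /eqP->.
    apply: eq_bigr => b bl; rewrite (big_pred1 (Ordinal bl))//.
  apply: (@le_trans _ _ (\sum_(j < l) 1 / gam)); last first.
    by rewrite sumr_const card_ord mul1r mulr_natl.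
  apply: ler_sum => j _; rewrite -big_distrl/= ler_pM2r ?invr_gt0//.
  rewrite -(Wpmf (a j)).2 [leRHS](bigID (fun b => dec b == j))/= lerDl.
  by apply: sumr_ge0 => b _.
apply: (@le_trans _ _ (bad + \sum_(b | (dec b < l)%N) QW b)); last by rewrite lerD2l.
rewrite [X in _ + X]exchange_big/= -big_split/=; apply: ler_sum => a1 _.
rewrite big_distrr/= big_mkcond [X in _ <= X + _]big_mkcond.
rewrite [X in _ <= _ + X]big_mkcond -big_split/=; apply: ler_sum => b _.
rewrite /used; case: ifP; case: ifP => //= _; case: ifP => // _ _;
  rewrite ?addr0 ?add0r// ?lerDl; exact: mulr_ge0.
Qed.

End Feinstein.

Section Divergence.
Variable R : realType.

Lemma ln2_gt0 : 0 < ln 2 :> R.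
Proof. by apply: ln_gt0; rewrite ltr1n. Qed.

Lemma channel_information_pmf (X Y : finType) (q : X -> R) (W : X -> Y -> R) :
  (forall x, \sum_y W x y = 1) ->
  channel_information q W =
  \sum_x \sum_y q x * W x y * log2 (W x y / \sum_x' q x' * W x' y).
Proof.
move=> W1; apply: eq_bigr => x _; apply: eq_bigr => y _.
rewrite -big_distrr/= W1 mulr1.
have [->|q0] := eqVneq (q x) 0; first by rewrite !mul0r.
by rewrite -mulf_div divff// mul1r.
Qed.

(* The variational lower bound on the divergence of J from G = g / L, with   *)
(* the test function ln L * 1(dec b = m).                                    *)
Lemma divergence_success_bound (M B : finType) (J : M -> B -> R) (g : B -> R)
    (dec : B -> M) :
  (forall m b, 0 <= J m b) -> \sum_m \sum_b J m b = 1 ->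
  (forall b, 0 <= g b) -> \sum_b g b = 1 ->
  (forall m b, 0 < J m b -> 0 < g b) ->
  (1 - \sum_m \sum_(b | dec b != m) J m b) * log2 #|M|%:R <=
  1 + \sum_m \sum_b J m b * log2 (J m b / (#|M|%:R^-1 * g b)).
Proof.
move=> J0 J1 g0 g1 Jg; set L : R := #|M|%:R.
have L0 : 0 < L.
  rewrite ltr0n; apply/card_gt0P; case: (pickP M) => [m _|M0]; first by exists m.
  by move: J1; rewrite big1 => [/eqP|m]; [rewrite eq_sym oner_eq0 | have := M0 m].
have Lge1 : 1 <= L by rewrite ler1n -(ltr0n R).
have -> : (1 - \sum_m \sum_(b | dec b != m) J m b) * log2 L =
   \sum_m \sum_b J m b * (if dec b == m then log2 L else 0).
  rewrite -J1 -sumrB big_distrl/=; apply: eq_bigr => m _.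
  rewrite (bigID (fun b => dec b == m))/= addrK big_distrl/= big_mkcond.
  by apply: eq_bigr => b _; case: ifP => _; rewrite ?mulr0.
rewrite -lerBlDr -sumrB.
(* This is the reference law multiplied by the exponential of the test function. Its mass is at most
   2, which costs the one extra bit. The termwise inequality below is ln z <= z - 1 with z = tilt /
   (2 J). *)
pose tilt m b := if dec b == m then g b else L^-1 * g b.
apply: (@le_trans _ _ (\sum_m \sum_b
    (J m b + tilt m b / (2 * ln 2) - J m b / ln 2))).
  apply: ler_sum => m _; rewrite -sumrB; apply: ler_sum => b _.
  have [J00|Jp] := eqVneq (J m b) 0.
    rewrite J00 !mul0r subrr add0r subr0; apply: divr_ge0.
      by rewrite /tilt; case: ifP => _//; rewrite mulr_ge0// invr_ge0 ltW.
    by rewrite mulr_ge0// ltW// ln2_gt0.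
  have {}Jp : 0 < J m b by rewrite lt_neqAle eq_sym Jp J0.
  have gp := Jg _ _ Jp.
  set e : R := if dec b == m then L else 1.
  have e0 : 0 < e by rewrite /e; case: ifP.
  have -> : (if dec b == m then log2 L else 0) = ln e / ln 2.
    by rewrite /e; case: ifP => _; rewrite /log2// ln1 mul0r.
  have -> : tilt m b = e * (L^-1 * g b).
    rewrite /tilt /e; by case: ifP => _; rewrite ?mul1r// mulrA divff ?mul1r// gt_eqF.
  have Lg0 : 0 < L^-1 * g b by rewrite mulr_gt0// invr_gt0.
  rewrite -mulrBr /log2 -mulrBl.
  rewrite -(ler_pM2r ln2_gt0).
  have l2 := gt_eqF ln2_gt0.
  have -> : J m b * ((ln e - ln (J m b / (L^-1 * g b))) / ln 2) * ln 2 =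
     J m b * (ln e - ln (J m b / (L^-1 * g b))) by field; rewrite l2.
  have -> : (J m b + e * (L^-1 * g b) / (2 * ln 2) - J m b / ln 2) * ln 2 =
     J m b * (ln 2 + (e * (L^-1 * g b) / (2 * J m b) - 1)).
    by field; rewrite l2 gt_eqF// gt_eqF.
  rewrite ler_pM2l//.
  set z := e * (L^-1 * g b) / (2 * J m b).
  have z0 : 0 < z by rewrite divr_gt0// mulr_gt0.
  have -> : ln e - ln (J m b / (L^-1 * g b)) = ln 2 + ln z.
    rewrite -ln_div ?posrE// ?divr_gt0//; rewrite -lnM ?posrE//; congr ln.
    rewrite /z; field; rewrite !gt_eqF//.
  rewrite lerD2l; have := @le_ln1Dx R (z - 1); rewrite addrCA subrr addr0; apply.
  by rewrite ltrBrDr addNr.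
have -> : \sum_m \sum_b (J m b + tilt m b / (2 * ln 2) - J m b / ln 2) =
    1 + (\sum_m \sum_b tilt m b) / (2 * ln 2) - (ln 2)^-1.
  transitivity (\sum_m \sum_b J m b + (\sum_m \sum_b tilt m b) / (2 * ln 2) -
    (\sum_m \sum_b J m b) / ln 2); last by rewrite J1 mul1r.
  rewrite !big_distrl/= -big_split -sumrB/=; apply: eq_bigr => m _.
  by rewrite !big_distrl/= -big_split -sumrB/=; apply: eq_bigr.
suff : \sum_m \sum_b tilt m b <= 2.
  move=> h; rewrite -addrA gerDl subr_le0 invfM mulrA ler_piMl//.
    by rewrite invr_ge0 ltW// ln2_gt0.
  by rewrite ler_pdivrMr// mul1r.
rewrite exchange_big/=.
apply: (@le_trans _ _ (\sum_b (g b + g b))); last by rewrite big_split/= g1 -[1 + 1]/2.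
apply: ler_sum => b _; rewrite (bigD1 (dec b))//= {1}/tilt eqxx lerD2l.
apply: (@le_trans _ _ (\sum_(m : M) L^-1 * g b)).
  rewrite [leRHS](bigD1 (dec b))//= -[leLHS]add0r lerD//.
    by rewrite mulr_ge0// invr_ge0 ltW.
  by apply: ler_sum => m /negbTE h; rewrite /tilt eq_sym h.
by rewrite sumr_const -mulr_natl mulrA divff ?mul1r// gt_eqF.
Qed.

End Divergence.

(** * Optimal input laws *)

Section Maximizer.
Local Open Scope classical_set_scope.
Variable R : realType.

Definition entropy_term (t : R) : R := - (t * log2 t).

(** The bound ln x < x taken at x = 1 / sqrt t. It gives the continuity of t ln t at 0. *)
Lemma norm_mul_ln_le (t : R) : 0 < t -> t <= 1 -> `|t * ln t| <= 2 * Num.sqrt t.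
Proof.
move=> t0 t1; have s0 : 0 < Num.sqrt t by rewrite sqrtr_gt0.
have st : t = Num.sqrt t ^+ 2 by rewrite sqr_sqrtr// ltW.
have lns : ln (Num.sqrt t)^-1 < (Num.sqrt t)^-1 by rewrite ln_sublinear// invr_gt0.
rewrite ler0_norm; last by rewrite mulr_ge0_le0 ?ln_le0// ltW.
rewrite {1 2}st lnXn// -mulrN -mulNrn -lnV//.
apply: (@le_trans _ _ (Num.sqrt t ^+ 2 * ((Num.sqrt t)^-1 *+ 2))).
  by rewrite ler_pM2l ?exprn_gt0// lerMn2r ltW.
by rewrite expr2 mulrnAr -mulrA divff ?gt_eqF// mulr1 mulr_natl.
Qed.

(** The logarithm is 0 on nonpositive reals, so the function vanishes on the left of 0, while
    [norm_mul_ln_le] controls it on the right. *)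
Lemma continuous_entropy_term : continuous entropy_term.
Proof.
have ct : continuous (fun t : R => t * ln t).
  move=> t; have [t0|t0|->] := ltgtP t 0.
  - rewrite /continuous_at ln0 ?ltW// mulr0.
    have h : {near t, (fun=> 0 : R) =1 (fun x => x * ln x)}.
      near=> x; rewrite ln0 ?mulr0// ltW//.
      by near: x; exact: lt_nbhsl.
    exact: cvg_trans (near_eq_cvg h) (cvg_cst _).
  - by apply: continuousM => //; exact: continuous_ln.
  - rewrite /continuous_at mul0r; apply/cvgr0Pnorm_le => e e0.
    have c : (2 * Num.sqrt t @[t --> (0 : R)]) --> (0 : R).
      rewrite -[X in _ --> X](mulr0 2) -[X in _ * X]sqrtr0.
      by apply: cvgMl_tmp; exact: sqrt_continuous.
    near=> x.
    have [x0|x0] := leP x 0; first by rewrite ln0// mulr0 normr0 ltW.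
    apply: (le_trans (norm_mul_ln_le x0 _)).
      by apply: ltW; near: x; exact: lt_nbhsl.
    rewrite ltW//; near: x; exact: (cvgr_lt _ c).
move=> t; rewrite /entropy_term /log2; apply: cvgN.
under eq_cvg do rewrite mulrA.
by rewrite mulrA; apply: cvgMr_tmp; exact: ct.
Unshelve. all: by end_near. Qed.

(** Information is output entropy minus conditional output entropy. In this form it is visibly
    continuous in q, the second term being linear. *)
Lemma channel_information_entropy (X Y : finType) (q : X -> R)
    (W : X -> Y -> R) :
  (forall x, 0 <= q x) -> (forall x, is_pmf (W x)) ->
  channel_information q W =
  \sum_y (entropy_term (\sum_x q x * W x y) -
          \sum_x q x * entropy_term (W x y)).
Proof.
move=> q0 Wp; rewrite channel_information_pmf; last by move=> x; case: (Wp x).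
rewrite exchange_big/=; apply: eq_bigr => y _.
rewrite /entropy_term big_distrl/= -sumrN -sumrB; apply: eq_bigr => x _.
have W0 x' : 0 <= W x' y by case: (Wp x').
have [->|qx] := eqVneq (q x) 0; first by rewrite !(mul0r, oppr0, addr0).
have [->|wx] := eqVneq (W x y) 0; first by rewrite !(mulr0, mul0r, oppr0, addr0).
have wx0 : 0 < W x y by rewrite lt_neqAle eq_sym wx W0.
have qx0 : 0 < q x by rewrite lt_neqAle eq_sym qx q0.
have r0 : 0 < \sum_x' q x' * W x' y.
  rewrite (bigD1 x)//=; apply: ltr_wpDr; last exact: mulr_gt0.
  by apply: sumr_ge0 => i _; exact: mulr_ge0.
rewrite /log2 ln_div ?posrE//; ring.
Qed.

Lemma continuous_sum_fun (T : topologicalType) (I : finType)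
    (F : I -> T -> R) :
  (forall i, continuous (F i)) -> continuous (fun v => \sum_i F i v).
Proof.
move=> cF.
exact: (@continuous_big R I +%R 0 xpredT (@add_continuous R) _
  (index_enum I) F (fun i _ => cF i)).
Qed.

Lemma compact_simplex n : compact
  [set v : 'rV[R]_n | (forall i, 0 <= v ord0 i) /\ \sum_i v ord0 i = 1].
Proof.
have -> : [set v : 'rV[R]_n |
    (forall i, 0 <= v ord0 i) /\ \sum_i v ord0 i = 1] =
  [set v : 'rV[R]_n | forall i, `[0, 1]%classic (v ord0 i)] `&`
  (fun v : 'rV[R]_n => \sum_i v ord0 i) @^-1` [set 1].
  apply/seteqP; split=> v /= [v0 v1]; split=> // i; last first.
    by have := v0 i; rewrite /= in_itv/= => /andP[].
  rewrite in_itv/= v0/= -v1 (bigD1 i)//= lerDl; exact: sumr_ge0.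
apply: compact_closedI.
  have h := @rV_compact R n (fun=> `[0, 1]%classic) (fun=> @segment_compact R 0 1).
  exact: h.
apply: closed_comp => [v _|]; last exact: closed_eq.
exact: (continuous_sum_fun (fun i => @coord_continuous _ _ _ _ _)).
Qed.

(** A continuous function attains its maximum on the compact simplex. Input laws are encoded as row
    vectors to carry the topology. *)
Lemma exists_max_information (X Y U : finType) (p : X -> U -> Y -> R)
    (c : U -> R) : (0 < #|X|)%N -> (forall x u, is_pmf (p x u)) ->
  exists q : X -> R, is_pmf q /\ forall q', is_pmf q' ->
    \sum_u c u * channel_information q' (fun x y => p x u y) <=
    \sum_u c u * channel_information q (fun x y => p x u y).
Proof.
move=> /card_gt0P[x0 _] pp.
pose vec (q : X -> R) : 'rV[R]_#|X| := \row_i q (enum_val i).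
pose fn (v : 'rV[R]_#|X|) (x : X) : R := v ord0 (enum_rank x).
have vecK q : fn (vec q) = q by apply/funext => x; rewrite /fn mxE enum_rankK.
pose f (v : 'rV[R]_#|X|) := \sum_u c u * \sum_y
  (entropy_term (\sum_x fn v x * p x u y) -
   \sum_x fn v x * entropy_term (p x u y)).
have fE q : is_pmf q ->
    f (vec q) = \sum_u c u * channel_information q (fun x y => p x u y).
  move=> [q0 _]; apply: eq_bigr => u _; congr (_ * _).
  by rewrite channel_information_entropy// vecK.
pose V : topologicalType := 'rV[R]_#|X|.
have cfn x : continuous (fn ^~ x : V -> R) by exact: coord_continuous.
pose D := [set v : 'rV[R]_#|X| |
  (forall i, 0 <= v ord0 i) /\ \sum_i v ord0 i = 1].
have Dfn v : D v <-> is_pmf (fn v).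
  have -> : is_pmf (fn v) =
      ((forall x, 0 <= fn v x) /\ \sum_i v ord0 i = 1).
    congr (_ /\ _); rewrite [in RHS](reindex (@enum_rank X))//.
    by exists (@enum_val X X) => i _; rewrite (enum_rankK, enum_valK).
  split=> -[v0 v1]; split=> // i; first exact: v0.
  by rewrite -(enum_valK i); exact: v0.
have Dvec q : is_pmf q -> D (vec q) by move=> qp; apply/Dfn; rewrite vecK.
have D0 : D !=set0.
  exists (vec (fun x => (x == x0)%:R)); apply: Dvec; split => //.
  by rewrite (bigD1 x0)//= eqxx big1 ?addr0// => x /negbTE ->.
have cl (g : X -> R) : continuous (fun v : V => \sum_x fn v x * g x).
  apply: continuous_sum_fun => x v.
  exact: (@continuous_comp V R R (fn ^~ x) ( *%R^~ (g x)) v (cfn x v)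
    (@mulrr_continuous _ _ _)).
have ce u y : continuous (fun v : V =>
    entropy_term (\sum_x fn v x * p x u y) -
    \sum_x fn v x * entropy_term (p x u y)).
  move=> v; apply: (continuousB _ (cl _ v)).
  exact: (@continuous_comp V R R _ entropy_term v (cl _ v)
    (@continuous_entropy_term _)).
have cf0 : continuous (f : V -> R).
  apply: continuous_sum_fun => u v.
  have cu := @continuous_sum_fun _ _ _ (ce u).
  exact: (@continuous_comp V R R _ ( *%R (c u)) v (cu v)
    (@mulrl_continuous _ _ _)).
have cf : {within D, continuous f} by exact: continuous_subspaceT.
have [v vD vmax] := EVT_max_rV D0 (@compact_simplex _) cf.
have vE : v = vec (fn v).
  by apply/rowP => i; rewrite mxE /fn enum_valK.
have fnv : is_pmf (fn v) by apply/Dfn; rewrite inE in vD.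
exists (fn v); split=> // q' q'p; rewrite -!fE// -vE; apply: vmax.
by rewrite inE; exact: Dvec.
Qed.

End Maximizer.

(** * Averages over state paths *)

Section FiniteValued.
Local Open Scope classical_set_scope.
Context {R : realType} {d : measure_display} {Om : measurableType d}.
Variable P : probability Om R.

Lemma Pr_ge0 (E : set Om) : 0 <= Pr P E.
Proof. exact/fine_ge0/measure_ge0. Qed.

Lemma PrE (E : set Om) : measurable E -> (Pr P E)%:E = P E.
Proof. by move=> mE; rewrite /Pr fineK// fin_num_measure. Qed.

Lemma le_Pr (E F : set Om) :
  measurable E -> measurable F -> E `<=` F -> Pr P E <= Pr P F.
Proof.
by move=> mE mF EF; rewrite -lee_fin !PrE//; apply: le_measure; rewrite ?inE.
Qed.

Lemma Pr0 : Pr P set0 = 0.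
Proof. by rewrite /Pr measure0. Qed.

Lemma PrT : Pr P setT = 1.
Proof. by rewrite /Pr probability_setT. Qed.

Lemma PrU (E F : set Om) : measurable E -> measurable F ->
  E `&` F = set0 -> Pr P (E `|` F) = Pr P E + Pr P F.
Proof.
move=> mE mF EF; apply/EFin_inj; rewrite EFinD !PrE ?measureU//.
exact: measurableU.
Qed.

Variables (I : finType) (Z : Om -> I).
Hypothesis mZ : forall i, measurable [set w | Z w = i].

Lemma Pr_mem_seq (s : seq I) : uniq s ->
  measurable [set w | Z w \in s] /\
  Pr P [set w | Z w \in s] = \sum_(i <- s) Pr P [set w | Z w = i].
Proof.
elim: s => [_|i s IH /andP[iNs us]].
  have -> : [set w | Z w \in [::]] = set0 by rewrite -subset0.
  by rewrite big_nil Pr0; split.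
have [ms IHs] := IH us.
have -> : [set w | Z w \in i :: s] = [set w | Z w = i] `|` [set w | Z w \in s].
  apply/seteqP; split=> w /=; first by rewrite inE => /orP[/eqP|]; [left|right].
  by rewrite inE => -[->|->]; rewrite ?eqxx ?orbT.
split; first exact: measurableU.
rewrite big_cons PrU// ?IHs// -subset0 => w /= [->].
by rewrite (negbTE iNs).
Qed.

Lemma measurable_finite (Q : pred I) : measurable [set w | Q (Z w)].
Proof.
have [+ _] := Pr_mem_seq (filter_uniq Q (enum_uniq I)).
by under eq_set do rewrite mem_filter mem_enum andbT.
Qed.

Lemma Pr_finite (Q : pred I) :
  Pr P [set w | Q (Z w)] = \sum_(i | Q i) Pr P [set w | Z w = i].
Proof.
have [_] := Pr_mem_seq (filter_uniq Q (enum_uniq I)).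
under eq_set do rewrite mem_filter mem_enum andbT.
by rewrite big_filter big_enum_cond.
Qed.

End FiniteValued.

Section Paths.
Local Open Scope classical_set_scope.
Variables (U : finType) (u0 : U).

(** Padding finite paths to infinite ones lets the same functional be averaged over paths of
    different lengths; [depends_below] ensures that the padding is not seen. *)
Definition extend N (u : {ffun 'I_N -> U}) (i : nat) : U :=
  if insub i is Some j then u j else u0.

Definition prefix_ffun N (s : nat -> U) : {ffun 'I_N -> U} := [ffun i => s (val i)].

Definition depends_below (A : Type) N (F : (nat -> U) -> A) : Prop :=
  forall s s', (forall i, (i < N)%N -> s i = s' i) -> F s = F s'.

Lemma extend_ord N (u : {ffun 'I_N -> U}) (i : 'I_N) : extend u i = u i.
Proof. by rewrite /extend valK. Qed.

Lemma extend_lt N (u : {ffun 'I_N -> U}) i (iN : (i < N)%N) :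
  extend u i = u (Ordinal iN).
Proof. exact: (extend_ord u (Ordinal iN)). Qed.

Lemma extend_prefix N s i : (i < N)%N -> extend (prefix_ffun N s) i = s i.
Proof. by move=> iN; rewrite (extend_lt _ iN) ffunE. Qed.

Lemma prefix_eq N s (u : {ffun 'I_N -> U}) :
  (prefix_ffun N s = u) <-> (forall i, (i < N)%N -> s i = extend u i).
Proof.
split=> [<- i iN|h]; first by rewrite extend_prefix.
by apply/ffunP => i; rewrite ffunE (h i (ltn_ord i)); exact: extend_ord.
Qed.

Section Process.
Context {R : realType} {d : measure_display} {Om : measurableType d}.
Variables (P : probability Om R) (S : nat -> Om -> U).
Hypothesis procS : is_process S.

Lemma state_law_prefix N (u : {ffun 'I_N -> U}) :
  state_law P S u = Pr P [set w | prefix_ffun N (S ^~ w) = u].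
Proof.
congr Pr; apply/seteqP; split=> w /= h.
  by apply/ffunP => i; rewrite ffunE; exact: h.
by move=> i; rewrite -h ffunE.
Qed.

Lemma measurable_prefix N (u : {ffun 'I_N -> U}) :
  measurable [set w | prefix_ffun N (S ^~ w) = u].
Proof.
rewrite (_ : [set w | _] = \bigcap_(i in [set: 'I_N]) [set w | S i w = u i]).
  by apply: fin_bigcap_measurable => // i _; exact: procS.
apply/seteqP; split=> w /=; first by move=> <- i _ /=; rewrite ffunE.
by move=> h; apply/ffunP => i; rewrite ffunE (h i).
Qed.

Lemma event_prefix N (Q : (nat -> U) -> bool) : depends_below N Q ->
  [set w | Q (S ^~ w)] = [set w | Q (extend (prefix_ffun N (S ^~ w)))].
Proof.
move=> dQ; apply: eq_set => w; congr is_true.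
by apply: dQ => i iN; rewrite extend_prefix.
Qed.

Lemma measurable_event N (Q : (nat -> U) -> bool) : depends_below N Q ->
  measurable [set w | Q (S ^~ w)].
Proof.
move=> dQ; rewrite (event_prefix dQ).
exact: (measurable_finite P (@measurable_prefix N) (Q \o @extend N)).
Qed.

Lemma Pr_event N (Q : (nat -> U) -> bool) : depends_below N Q ->
  Pr P [set w | Q (S ^~ w)] = \sum_(u | Q (extend u)) state_law P S (N := N) u.
Proof.
move=> dQ; rewrite (event_prefix dQ).
rewrite (Pr_finite P (@measurable_prefix N) (Q \o @extend N)).
by apply: eq_bigr => u _; rewrite state_law_prefix.
Qed.

Lemma state_law_ge0 N (u : {ffun 'I_N -> U}) : 0 <= state_law P S u.
Proof. exact: Pr_ge0. Qed.

Lemma state_law_sum N : \sum_(u : {ffun 'I_N -> U}) state_law P S u = 1.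
Proof.
rewrite -(Pr_event (Q := xpredT))// -(PrT P); congr Pr.
by apply/seteqP; split.
Qed.

Definition path_mean N (F : (nat -> U) -> R) : R :=
  \sum_(u : {ffun 'I_N -> U}) state_law P S u * F (extend u).

Lemma path_meanD N F G :
  path_mean N (fun s => F s + G s) = path_mean N F + path_mean N G.
Proof. by rewrite -big_split; apply: eq_bigr => u _; rewrite mulrDr. Qed.

Lemma path_mean_sum (I : Type) (r : seq I) (Q : pred I) N F :
  path_mean N (fun s => \sum_(i <- r | Q i) F i s) =
  \sum_(i <- r | Q i) path_mean N (F i).
Proof. by rewrite exchange_big; apply: eq_bigr => u _; rewrite big_distrr. Qed.

Lemma path_meanZ N a F : path_mean N (fun s => a * F s) = a * path_mean N F.
Proof. by rewrite big_distrr; apply: eq_bigr => u _; rewrite mulrCA. Qed.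

Lemma path_mean_cst N a : path_mean N (fun=> a) = a.
Proof. by rewrite /path_mean -big_distrl state_law_sum/= mul1r. Qed.

Lemma path_mean_indic N (Q : (nat -> U) -> bool) : depends_below N Q ->
  path_mean N (fun s => (Q s)%:R) = Pr P [set w | Q (S ^~ w)].
Proof.
move=> dQ; rewrite (Pr_event dQ) [RHS]big_mkcond; apply: eq_bigr => u _.
by case: ifP => _; rewrite ?mulr1 ?mulr0.
Qed.

(** Consistency of the finite-dimensional laws: summing the law of long paths over all continuations
    of a prefix gives the law of the prefix. *)
Lemma path_mean_prefix n N F : (n <= N)%N -> depends_below n F ->
  path_mean N F = path_mean n F.
Proof.
move=> nN dF.
rewrite /path_mean (partition_big (fun u : {ffun 'I_N -> U} =>
  prefix_ffun n (extend u)) xpredT)//=.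
apply: eq_bigr => z _.
have dQ : depends_below N (fun s => prefix_ffun n s == z).
  move=> s s' h; congr (_ == _); apply/ffunP => i; rewrite !ffunE; apply: h.
  exact: leq_trans (ltn_ord i) nN.
transitivity (F (extend z) * Pr P [set w | prefix_ffun n (S ^~ w) == z]).
  rewrite (Pr_event dQ) big_distrr/=; apply: eq_bigr => u /eqP <-.
  rewrite mulrC; congr (_ * _); apply: dF => i iN; rewrite extend_prefix//.
rewrite state_law_prefix mulrC; congr (Pr _ _ * _).
by apply/seteqP; split=> w /= /eqP.
Qed.

End Process.
End Paths.

(** * Stationary Markov states *)

Section MarkovStates.
Local Open Scope classical_set_scope.
Context {R : realType} {d : measure_display} {Om : measurableType d}.
Variables (P : probability Om R) (U : finType) (u0 : U) (S : nat -> Om -> U).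
Hypothesis procS : is_process S.
Hypothesis statS : stationary P S.

Local Notation mean := (path_mean u0 P S).
Local Notation st := (state_trans P S).
Local Notation pi := (feedback_prob P S).

Lemma Pr_shift m n (Q : (nat -> U) -> bool) : depends_below n Q ->
  Pr P [set w | Q (fun i => S (m + i)%N w)] = Pr P [set w | Q (S ^~ w)].
Proof.
move=> dQ; rewrite (Pr_event u0 P procS dQ).
have procS' : is_process (fun i => S (m + i)%N) by move=> i a; exact: procS.
rewrite (Pr_event u0 P procS' dQ); apply: eq_bigr => u _.
have eE (Z : nat -> Om -> U) : [set w | forall i : 'I_n, Z i w = u i] =
    [set w | forall i, (i < n)%N -> Z i w = extend u0 u i].
  apply/seteqP; split=> w /= h i; first by move=> iN; rewrite extend_lt -h.
  by rewrite h// extend_ord.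
by rewrite /state_law (eE (fun i => S (m + i)%N)) (eE S); exact: statS.
Qed.

Lemma measurable_at (Q : pred U) i : measurable [set w | Q (S i w)].
Proof. exact: (measurable_finite P (procS i) Q). Qed.

Lemma feedback_prob_ge0 v : 0 <= pi v.
Proof. exact: Pr_ge0. Qed.

Lemma Pr_at m v : Pr P [set w | S m w = v] = pi v.
Proof.
have := @Pr_shift m 1 (fun s => s 0%N == v); rewrite addn0.
have eE i : [set w | S i w == v] = [set w | S i w = v].
  by apply: eq_set => w; apply/propext; split => /eqP.
by rewrite !eE; apply => s s' h; rewrite h.
Qed.

Lemma Pr_pair m k a v :
  Pr P ([set w | S (m + k)%N w = a] `&` [set w | S m w = v]) =
  Pr P ([set w | S k w = a] `&` [set w | S 0%N w = v]).
Proof.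
have := @Pr_shift m k.+1 (fun s => (s k == a) && (s 0%N == v)); rewrite addn0.
have eE i j : [set w | (S i w == a) && (S j w == v)] =
    [set w | S i w = a] `&` [set w | S j w = v].
  apply: eq_set => w; apply/propext; split => [/andP[/eqP ? /eqP ?]|[/eqP ? /eqP ?]].
    by split.
  exact/andP.
by rewrite !eE; apply => s s' h; rewrite !h.
Qed.

Lemma le_pair_feedback m k a v :
  Pr P ([set w | S (m + k)%N w = a] `&` [set w | S m w = v]) <= pi v.
Proof.
rewrite -(Pr_at m); apply: le_Pr; [|exact: procS|by move=> w []].
by apply: measurableI; exact: procS.
Qed.

(** The product form of conditioning also holds for a null v, where both sides vanish. *)
Lemma state_trans_pair m k a v :
  Pr P ([set w | S (m + k)%N w = a] `&` [set w | S m w = v]) = st k a v * pi v.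
Proof.
rewrite Pr_pair /state_trans /cPr.
have [pv|pv] := eqVneq (pi v) 0; last by rewrite divfK.
rewrite pv mulr0; apply/eqP; rewrite eq_le Pr_ge0 andbT -pv.
exact: (le_pair_feedback 0).
Qed.

Lemma state_trans_null k a v : pi v = 0 -> st k a v = 0.
Proof. by rewrite /state_trans /cPr /feedback_prob => ->; rewrite invr0 mulr0. Qed.

Lemma sum_feedback_prob : \sum_v pi v = 1.
Proof.
rewrite -(PrT P) -(Pr_finite P (procS 0) xpredT); congr Pr.
by apply/seteqP; split.
Qed.

Lemma mean_at m N g : (m < N)%N -> mean N (fun s => g (s m)) = \sum_v pi v * g v.
Proof.
move=> mN.
have -> : mean N (fun s => g (s m)) = mean N (fun s => \sum_v g v * (s m == v)%:R).
  apply: eq_bigr => u _; congr (_ * _).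
  rewrite (bigD1 (extend u0 u m))//= eqxx mulr1 big1 ?addr0// => v.
  by rewrite eq_sym => /negbTE ->; rewrite mulr0.
rewrite path_mean_sum; apply: eq_bigr => v _; rewrite path_meanZ mulrC; congr (_ * _).
rewrite path_mean_indic// => [|s s' h]; last by rewrite h.
by rewrite -(Pr_at m); congr Pr; apply/seteqP; split=> w /= /eqP.
Qed.

Lemma state_law_feedback_prob N (u : {ffun 'I_N -> U}) m : (m < N)%N ->
  0 < state_law P S u -> 0 < pi (extend u0 u m).
Proof.
move=> mN; apply: contraTT; rewrite -!leNgt => pim.
apply: le_trans pim; rewrite -(Pr_at m) state_law_prefix; apply: le_Pr.
- exact: measurable_prefix.
- exact: procS.
- by move=> w /= <-; rewrite extend_prefix.
Qed.

(** By stationarity a path of positive probability visits only states with positive [feedback_prob],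
    so the comparison is required on those alone. The converse needs this, as its single-letter
    bound is available only for such states. *)
Lemma le_mean m N F G : (m < N)%N -> (forall s, 0 < pi (s m) -> F s <= G s) ->
  mean N F <= mean N G.
Proof.
move=> mN FG; apply: ler_sum => u _.
have := state_law_ge0 P S u; rewrite le_eqVlt => /predU1P[<-|lu].
  by rewrite !mul0r.
by rewrite ler_pM2l//; apply: FG; exact: state_law_feedback_prob.
Qed.

Hypothesis markovS : markov_process P S.

(** The Markov property as a product, so that it extends to null pasts and to k = 0; the latter is
    computed directly, [markov_process] being stated for k > 0. *)
Lemma Pr_past_state m k (z : {ffun 'I_m.+1 -> U}) a :
  Pr P ([set w | S (m + k)%N w = a] `&` [set w | prefix_ffun m.+1 (S ^~ w) = z]) =
  st k a (extend u0 z m) * state_law P S z.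
Proof.
rewrite state_law_prefix; set past := [set w | _ = z].
have mpast : measurable past by exact: measurable_prefix.
have mS i b : measurable [set w | S i w = b] by exact: procS.
have past_m : past `<=` [set w | S m w = extend u0 z m].
  by move=> w /= <-; rewrite extend_prefix.
have pastE : past = [set w | forall i, (i <= m)%N -> S i w = extend u0 z i].
  by apply: eq_set => w; apply/propext; exact: prefix_eq.
have [p0|p0] := eqVneq (Pr P past) 0.
  rewrite p0 mulr0; apply/eqP; rewrite eq_le Pr_ge0 andbT -p0.
  apply: le_Pr => //; exact: measurableI.
have pgt : 0 < Pr P past by rewrite lt_neqAle eq_sym p0 Pr_ge0.
have pim : 0 < pi (extend u0 z m).
  by rewrite -(Pr_at m); apply: lt_le_trans pgt _; exact: le_Pr.
apply: (canRL (divfK p0)); have [->|k0] := posnP k.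
  have -> : st 0 a (extend u0 z m) = (a == extend u0 z m)%:R.
    rewrite /state_trans /cPr.
    apply: (canLR (mulfK (lt0r_neq0 pim))).
    have [->|an] := eqVneq a.
      by rewrite setIid mul1r.
    rewrite (_ : _ `&` _ = set0) ?Pr0 ?mul0r//.
    by rewrite -subset0 => w /= [h1 h2]; move: an; rewrite -h1 h2 eqxx.
  rewrite addn0; apply: (canLR (mulfK p0)); have [->|an] := eqVneq a.
    by rewrite mul1r setIC; congr Pr; exact/setIidl.
  rewrite mul0r (_ : _ `&` _ = set0) ?Pr0//.
  rewrite -subset0 => w /= [h1 /past_m/= h2].
  by move: an; rewrite -h1 h2 eqxx.
have := @markovS m k (extend u0 z) a k0; rewrite /= -pastE => /(_ pgt).
rewrite /cPr => ->; rewrite state_trans_pair Pr_at mulfK//.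
exact: lt0r_neq0.
Qed.

(** Conditional expectation given the states up to time m, obtained by grouping the paths by their
    prefix and their value at time m + k. Both the converse and the martingale argument use the
    Markov property in this form. *)
Lemma mean_markov m k N (Phi : (nat -> U) -> U -> R) : (m + k < N)%N ->
  (forall a, depends_below m.+1 (Phi ^~ a)) ->
  mean N (fun s => Phi s (s (m + k)%N)) =
  mean N (fun s => \sum_a st k a (s m) * Phi s a).
Proof.
move=> mkN dPhi; have mN : (m < N)%N by apply: leq_ltn_trans mkN; exact: leq_addr.
rewrite [RHS](path_mean_prefix u0 P procS mN); last first.
  move=> s s' h; apply: eq_bigr => a _.
  by rewrite (h m)// (dPhi a s s').
rewrite /path_mean (partition_big (fun u : {ffun 'I_N -> U} =>
  prefix_ffun m.+1 (extend u0 u)) xpredT)//=.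
apply: eq_bigr => z _; rewrite big_distrr/=.
rewrite (partition_big (fun u : {ffun 'I_N -> U} => extend u0 u (m + k)%N) xpredT)//=.
apply: eq_bigr => a _; rewrite mulrA [_ * st _ _ _]mulrC -Pr_past_state.
have dQ : depends_below N (fun s : nat -> U =>
    (prefix_ffun m.+1 s == z) && (s (m + k)%N == a)).
  move=> s s' h; rewrite h//; congr ((_ == _) && _).
  apply/ffunP => i; rewrite !ffunE; apply: h.
  by apply: leq_trans mN; exact: ltn_ord.
transitivity (Phi (extend u0 z) a *
    Pr P [set w | (prefix_ffun m.+1 (S ^~ w) == z) && (S (m + k)%N w == a)]).
  rewrite (Pr_event u0 P procS dQ) big_distrr/=.
  apply: eq_bigr => u /andP[/eqP <- /eqP <-].
  by rewrite mulrC; congr (_ * _); apply: dPhi => i im; rewrite extend_prefix.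
rewrite mulrC; congr (Pr _ _ * _); apply/seteqP; split=> w /=.
  by move=> /andP[/eqP ? /eqP ?]; split.
by move=> [<- <-]; rewrite !eqxx.
Qed.

End MarkovStates.

(** * Ergodicity of the fed-back states *)

Section ErgodicStates.
Local Open Scope classical_set_scope.
Context {R : realType} {d : measure_display} {Om : measurableType d}.
Variables (P : probability Om R) (U : finType) (u0 : U) (S : nat -> Om -> U).
Hypothesis procS : is_process S.
Hypothesis statS : stationary P S.
Hypothesis markovS : markov_process P S.
Variable T : nat.

Local Notation mean := (path_mean u0 P S).
Local Notation st := (state_trans P S).
Local Notation pi := (feedback_prob P S).

(** By stationarity both squares have the mean of h^2, and by harmonicity so does the cross product;
    hence the mean squared increment is 0. *)
Lemma harmonic_increment (h : U -> R) m :
  (forall v, h v = \sum_a st T a v * h a) ->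
  Pr P [set w | h (S (m + T)%N w) != h (S m w)] = 0.
Proof.
move=> hh; set N := (m + T).+1.
have mN : (m < N)%N by rewrite ltnS leq_addr.
have mTN : (m + T < N)%N by [].
have z : mean N (fun s => (h (s (m + T)%N) - h (s m)) ^+ 2) = 0.
  pose F1 s := h (s (m + T)%N) ^+ 2; pose F2 (s : nat -> U) := h (s m) ^+ 2.
  pose F3 s := h (s m) * h (s (m + T)%N).
  have F3E : mean N F3 = mean N F2.
    rewrite (mean_markov u0 procS statS markovS (Phi := fun s a => h (s m) * h a))//.
      apply: eq_bigr => u _; congr (_ * _).
      under eq_bigr do rewrite mulrCA.
      by rewrite -big_distrr/= -hh /F2 expr2.
    by move=> a s s' e; rewrite e.
  have F12 : mean N F1 = mean N F2.
    by rewrite !(mean_at u0 procS statS (fun v => h v ^+ 2)).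
  transitivity (mean N (fun s => F1 s + (F2 s + (- 2) * F3 s))).
    by apply: eq_bigr => u _; congr (_ * _); rewrite /F1 /F2 /F3; ring.
  by rewrite 2!path_meanD path_meanZ F3E F12; ring.
rewrite (Pr_event u0 P procS (N := N)
  (Q := fun s => h (s (m + T)%N) != h (s m))); last first.
  by move=> s s' e; rewrite !e.
apply: big1 => u hu.
have F0 (v : {ffun 'I_N -> U}) : true -> 0 <= state_law P S v *
    (h (extend u0 v (m + T)%N) - h (extend u0 v m)) ^+ 2.
  by move=> _; rewrite mulr_ge0 ?sqr_ge0// state_law_ge0.
have /eqP := psumr_eq0P F0 z (i := u) isT.
by rewrite mulf_eq0 sqrf_eq0 subr_eq0 (negbTE hu) orbF => /eqP.
Qed.

(** Stated for any class closed under complements and countable unions, to serve both on the path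
    space and on the probability space. *)
Lemma tail_closed (A Om' : Type) (M : set (set Om')) (Z : nat -> Om' -> A)
    (Q : pred A) :
  (forall B, M B -> M (~` B)) ->
  (forall F : nat -> set Om', (forall i, M (F i)) -> M (\bigcup_i F i)) ->
  (forall i, M [set w | Q (Z i w)]) ->
  M [set w | exists n, forall i, (n <= i)%N -> Q (Z i w)].
Proof.
move=> MC MU MZ; rewrite (_ : [set w | _] =
    \bigcup_n ~` \bigcup_i ~` [set w | Q (Z (n + i)%N w)]).
  apply: (MU) => n; apply: (MC); apply: (MU) => i; apply: (MC); exact: MZ.
apply/seteqP; split=> w /=.
  by move=> [n h]; exists n => // -[i _ /=]; apply; apply: h; exact: leq_addr.
move=> [n _ h]; exists n => i ni; apply/negPn/negP => q; apply: h.
by exists (i - n)%N => //=; rewrite subnKC//; exact/negP.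
Qed.

Hypothesis ergS : ergodic P (sampled_pair S T 0).

(* A harmonic function of the fed-back chain is almost surely constant along *)
(* the path, so its level sets are invariant.                                *)
Lemma harmonic_constant (h : U -> R) :
  (forall v, h v = \sum_a st T a v * h a) ->
  exists c, forall v, 0 < pi v -> h v = c.
Proof.
move=> hh.
have [[v1 pv1]|nov] := pselect (exists v, 0 < pi v); last first.
  by exists 0 => v pv; case: nov; exists v.
exists (h v1) => v pv; apply/eqP/negPn/negP => hv.
pose c := h v1; pose Q (a : U * U) := h a.2 == c.
(* Ergodicity is stated for exactly invariant events, whereas the event that h equals c at time 0 is
   invariant only up to a null set. The eventual version is exactly invariant and differs from it by
   a null set. *)
pose B := [set s : nat -> U * U | exists n, forall i, (n <= i)%N -> Q (s i)].
have mB : <<s cylinders (A := U * U) >> B.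
  have sC (D : set (nat -> U * U)) : <<s cylinders (A := U * U) >> D ->
      <<s cylinders (A := U * U) >> (~` D).
    by rewrite -setTD; exact: sigma_algebraCD.
  apply: (@tail_closed _ _ <<s cylinders (A := U * U) >> (fun i s => s i)) => // [F|i].
    exact: sigma_algebra_bigcup.
  rewrite (_ : [set s | _] = \bigcup_k
    (if unpickle k is Some a then if Q a then [set s : nat -> U * U | s i = a]
     else set0 else set0)).
    apply: sigma_algebra_bigcup => k; case: unpickle => [a|].
      case: ifP => _; last exact: sigma_algebra0.
      by apply: sub_gen_smallest; exists i, a.
    exact: sigma_algebra0.
  apply/seteqP; split=> s /=.
    by move=> q; exists (pickle (s i)) => //; rewrite pickleK q.
  move=> [k _]; case: unpickle => // a; case: ifP => // qa.
  by move=> /= ->.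
have shB : shift_seq (A := U * U) @^-1` B = B.
  apply/seteqP; split=> s [n hn].
    by exists n.+1 => -[//|i] /hn.
  by exists n => i ni; apply: hn; rewrite leqW.
have mat i := measurable_at P procS (fun a => h a == c) i.
have mC i : measurable [set w | Q (sampled_pair S T 0 i w)] by exact: mat.
have mBZ : measurable [set w | exists n, forall i, (n <= i)%N ->
    Q (sampled_pair S T 0 i w)].
  apply: tail_closed => //; [exact: measurableC|exact: bigcupT_measurable].
pose E i := [set w | h (S (T * i + T)%N w) != h (S (T * i)%N w)].
have mE i : measurable (E i).
  apply: (measurable_event u0 P procS (N := (T * i + T).+1)
    (Q := fun s => h (s (T * i + T)%N) != h (s (T * i)%N))).
  by move=> s s' e; rewrite !e// ltnS leq_addr.
have E0 : Pr P (\bigcup_i E i) = 0.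
  have mbE : measurable (\bigcup_i E i) by exact: bigcupT_measurable.
  apply/EFin_inj; rewrite PrE//.
  apply/eqP; rewrite -measure_le0.
  apply: (le_trans (measure_sigma_subadditive _ _ _ (@subset_refl _ _))) => //.
  by rewrite eseries0// => i _ _ /=; rewrite -PrE// harmonic_increment.
set BZ := [set w | exists n, _] in mBZ.
have sameE w : ~ (\bigcup_i E i) w -> BZ w <-> h (S 0%N w) == c.
  move=> nE; have cst i : h (S (T * i)%N w) = h (S 0%N w).
    elim: i => [|i IH]; first by rewrite muln0.
    rewrite -IH mulnS addnC; apply/eqP/negPn/negP => e.
    by apply: nE; exists i.
  have qE i : Q (sampled_pair S T 0 i w) = (h (S 0%N w) == c).
    by rewrite /Q/= cst.
  split; first by move=> [n /(_ n (leqnn n))]; rewrite qE.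
  by move=> e; exists 0%N => i _; rewrite qE.
pose C0 := [set w | h (S 0%N w) == c].
have mC0 : measurable C0 by exact: mat.
have mbE : measurable (\bigcup_i E i) by exact: bigcupT_measurable.
have le1 : Pr P BZ <= Pr P C0.
  rewrite -[leRHS]addr0 -E0; apply: (@le_trans _ _ (Pr P (C0 `|` \bigcup_i E i))).
    apply: le_Pr => //; first exact: measurableU.
    move=> w BZw; have [|/sameE h0] := pselect ((\bigcup_i E i) w); first by right.
    by left; apply/h0.
  by rewrite -!lee_fin EFinD !PrE//; [exact: measureU2|exact: measurableU].
have le2 : Pr P C0 <= Pr P BZ.
  rewrite -[leRHS]addr0 -E0; apply: (@le_trans _ _ (Pr P (BZ `|` \bigcup_i E i))).
    apply: le_Pr => //; first exact: measurableU.
    move=> w Cw; have [|/sameE h0] := pselect ((\bigcup_i E i) w); first by right.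
    by left; apply/h0.
  by rewrite -!lee_fin EFinD !PrE//; [exact: measureU2|exact: measurableU].
have C0BZ : Pr P C0 = Pr P BZ by apply/le_anti/andP.
have mv i : measurable [set w | S 0%N w = i] by exact: procS.
have pi_le : pi v1 <= Pr P C0.
  by apply: le_Pr => // w /= e; rewrite /C0/= e eqxx.
(* The level set of c contains the state v1 of positive mass, so it has probability 1, which leaves
   no mass for v. *)
have := ergS mB shB; rewrite -/BZ -C0BZ => -[C00|C01].
  by rewrite C00 leNgt pv1 in pi_le.
have : Pr P C0 + pi v <= 1.
  rewrite -PrU//; last first.
    by rewrite -subset0 => w /= [/eqP e1 e2]; rewrite e2 in e1; rewrite e1 eqxx in hv.
  by rewrite -(PrT P); apply: le_Pr => //; exact: measurableU.
by rewrite C01 gerDl leNgt pv.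
Qed.

End ErgodicStates.

(** * Poisson equation and variance of block sums *)

Section PoissonEquation.
Context {R : realType} {d : measure_display} {Om : measurableType d}.
Variables (P : probability Om R) (U : finType) (u0 : U) (S : nat -> Om -> U).
Hypothesis procS : is_process S.
Hypothesis statS : stationary P S.
Hypothesis markovS : markov_process P S.
Variable T : nat.
Hypothesis T_gt0 : (0 < T)%N.
Hypothesis ergS : ergodic P (sampled_pair S T 0).

Local Notation mean := (path_mean u0 P S).
Local Notation st := (state_trans P S).
Local Notation pi := (feedback_prob P S).

Lemma state_trans_invariant k a : \sum_v pi v * st k a v = pi a.
Proof.
rewrite -(mean_at u0 procS statS (m := 0) (N := k.+1) (st k a))//.
have -> : pi a = mean k.+1 (fun s => (s (0 + k)%N == a)%:R).
  rewrite (mean_at u0 procS statS (fun v => (v == a)%:R))//.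
  rewrite (bigD1 a)//= eqxx mulr1 big1 ?addr0// => v /negbTE ->.
  by rewrite mulr0.
rewrite (mean_markov u0 procS statS markovS (Phi := fun _ v => (v == a)%:R))//.
apply: eq_bigr => u _; congr (_ * _); rewrite (bigD1 a)//= eqxx mulr1.
by rewrite big1 ?addr0// => v /negbTE ->; rewrite mulr0.
Qed.

(* The harmonic functions of the fed-back chain form a line, so the range of *)
(* 1 - Q is a hyperplane, namely the functions of mean 0.                    *)
Lemma poisson_equation (F : U -> R) : \sum_v pi v * F v = 0 ->
  exists g : U -> R, forall v, F v = g v - \sum_a st T a v * g a.
Proof.
move=> F0; pose n := #|U|.
pose B : 'M[R]_n := \matrix_(i, j) ((i == j)%:R - st T (enum_val i) (enum_val j)).
(* The kernel is spanned by the indicator of the states of positive mass, not by the constants: out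
   of a null state all transition weights are 0, so a harmonic function vanishes there. *)
pose e : 'rV[R]_n := \row_j (0 < pi (enum_val j))%R%:R.
pose p : 'cV[R]_n := \col_j pi (enum_val j).
have BE (g : 'rV[R]_n) v : (g *m B) ord0 (enum_rank v) =
    g ord0 (enum_rank v) - \sum_a st T a v * g ord0 (enum_rank a).
  rewrite mxE; under eq_bigr do rewrite mxE mulrBr.
  rewrite sumrB; congr (_ - _).
    rewrite (bigD1 (enum_rank v))//= eqxx mulr1 big1 ?addr0// => i /negbTE ->.
    by rewrite mulr0.
  rewrite (reindex (@enum_rank U))/=; last first.
    by exists enum_val => i _; rewrite (enum_rankK, enum_valK).
  by apply: eq_bigr => a _; rewrite !enum_rankK mulrC.
have kerB : (kermx B <= e)%MS.
  apply/rV_subP => g /sub_kermxP gB.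
  have hh v : g ord0 (enum_rank v) = \sum_a st T a v * g ord0 (enum_rank a).
    by apply/eqP; rewrite -subr_eq0 -BE gB mxE.
  have [c hc] := harmonic_constant u0 procS statS markovS ergS hh.
  apply/sub_rVP; exists c; apply/rowP => j; rewrite !mxE.
  case: ltP => pj; first by rewrite mulr1 -(hc _ pj) enum_valK.
  have pj0 : pi (enum_val j) = 0.
    by apply/le_anti; rewrite pj (feedback_prob_ge0 P S).
  rewrite mulr0 -(enum_valK j) hh big1// => a _.
  by rewrite state_trans_null ?mul0r.
have rB : (n <= \rank B + 1)%N.
  have := mxrankS kerB; rewrite mxrank_ker leq_subLR => /leq_trans; apply.
  by rewrite leq_add2l rank_leq_row.
have Bp : B *m p = 0.
  apply/colP => i; rewrite !mxE.
  transitivity (pi (enum_val i) - \sum_v pi v * st T (enum_val i) v); last first.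
    by rewrite state_trans_invariant subrr.
  under eq_bigr do rewrite !mxE mulrBl.
  rewrite sumrB; congr (_ - _).
    rewrite (bigD1 i)//= eqxx mul1r big1 ?addr0// => j.
    by rewrite eq_sym => /negbTE ->; rewrite mul0r.
  rewrite [RHS](reindex (@enum_val U U))/=; last first.
    by exists enum_rank => j _; rewrite (enum_rankK, enum_valK).
  by apply: eq_bigr => j _; rewrite mulrC.
have p0 : p != 0.
  apply/eqP => pz; have := sum_feedback_prob P procS.
  rewrite big1 => [/eqP|v _]; first by rewrite eq_sym oner_eq0.
  by have /colP/(_ (enum_rank v)) := pz; rewrite !mxE enum_rankK.
have BK : (B <= kermx p)%MS by apply/sub_kermxP.
(* The range lies in the hyperplane orthogonal to the stationary law and has codimension at most 1,
   so the two coincide. *)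
have KB : (kermx p <= B)%MS.
  rewrite -(mxrank_leqif_sup BK) eqn_leq mxrankS//= mxrank_ker leq_subLR.
  by apply: leq_trans rB _; rewrite addnC leq_add2r lt0n mxrank_eq0.
have FK : (\row_j F (enum_val j) <= kermx p)%MS.
  apply/sub_kermxP/rowP => j; rewrite !mxE -[RHS]F0.
  rewrite [RHS](reindex (@enum_val U U))/=; last first.
    by exists enum_rank => i _; rewrite (enum_rankK, enum_valK).
  by apply: eq_bigr => i _; rewrite !mxE mulrC.
have /submxP[g Fg] := submx_trans FK KB.
exists (fun v => g ord0 (enum_rank v)) => v.
by rewrite -BE -Fg mxE enum_rankK.
Qed.

Variable f : nat -> U -> U -> R.

Let F v := \sum_(t < T) \sum_a st t a v * f t a v.
Let c := \sum_v pi v * F v.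

(* Adding the coboundary of a solution of the Poisson equation turns the     *)
(* centered block sums into martingale differences, whose variances add up.  *)
Lemma block_sum_second_moment : exists2 K, 0 <= K & forall M,
  mean (M * T) (fun s => (\sum_(i < M) \sum_(t < T)
    f t (s (T * i + t)%N) (s (T * i)%N) - M%:R * c) ^+ 2) <= K * M%:R.
Proof.
have [g Hg] : exists g : U -> R, forall v, F v - c = g v - \sum_a st T a v * g a.
  apply: poisson_equation; under eq_bigr do rewrite mulrBr.
  by rewrite sumrB -big_distrl/= sum_feedback_prob// mul1r subrr.
pose G := \sum_v `|g v|; pose Kf := \sum_(t < T) \sum_a \sum_v `|f t a v|.
have gG v : `|g v| <= G by rewrite /G (bigD1 v)//= lerDl sumr_ge0.
have G0 : 0 <= G by exact: sumr_ge0.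
have fK (t : 'I_T) a v : `|f t a v| <= \sum_a \sum_v `|f t a v|.
  rewrite (bigD1 a)//= (bigD1 v)//= -addrA lerDl addr_ge0 ?sumr_ge0// => b _.
  exact: sumr_ge0.
(* The martingale difference of block i: the centered block sum corrected by the increment of g over
   the block. *)
pose D i (s : nat -> U) := \sum_(t < T) f t (s (T * i + t)%N) (s (T * i)%N) - c +
  (g (s (T * i + T)%N) - g (s (T * i)%N)).
pose A i s := \sum_(j < i) D j s.
pose KD := (Kf + `|c| + (G + G)) ^+ 2.
have D2 i s : D i s ^+ 2 <= KD.
  rewrite -real_normK ?num_real// ler_sqr ?nnegrE ?addr_ge0//; last first.
    by apply: sumr_ge0 => t _; do 2!apply: sumr_ge0 => ? _.
  apply: (le_trans (ler_normD _ _)); apply: lerD.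
    apply: (le_trans (ler_normB _ _)); apply: lerD => //.
    by apply: (le_trans (ler_norm_sum _ _ _)); apply: ler_sum => t _; exact: fK.
  by apply: (le_trans (ler_normB _ _)); exact: lerD.
have depA i : depends_below (T * i).+1 (A i).
  move=> s s' h; apply: eq_bigr => j _.
  have jT : (T * j + T <= T * i)%N by rewrite -mulnSr leq_mul2l ltn_ord orbT.
  have hh k : (k <= T)%N -> s (T * j + k)%N = s' (T * j + k)%N.
    by move=> kT; apply: h; rewrite ltnS (leq_trans _ jT)// leq_add2l.
  have h0 : s (T * j)%N = s' (T * j)%N by have := hh 0%N isT; rewrite addn0.
  rewrite /D h0 hh//; congr (_ - _ + _); apply: eq_bigr => t _.
  by rewrite hh// ltnW.
(* Given the states up to time T * i, the block sum averages to F and the corrector to its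
   transition average; the Poisson equation makes the total 0. *)
have AD N i : (T * i + T < N)%N -> mean N (fun s => A i s * D i s) = 0.
  move=> iN; have m0 : (T * i < N)%N by apply: leq_ltn_trans iN; exact: leq_addr.
  transitivity (mean N (fun s =>
    \sum_(t < T) A i s * f t (s (T * i + t)%N) (s (T * i)%N) +
    (A i s * g (s (T * i + T)%N) + (- 1) * (A i s * (c + g (s (T * i)%N)))))).
    by apply: eq_bigr => u _; congr (_ * _); rewrite /D -big_distrr/=; ring.
  rewrite 2!path_meanD path_mean_sum path_meanZ.
  under eq_bigr => t _.
    rewrite (mean_markov u0 procS statS markovS
      (Phi := fun s a => A i s * f t a (s (T * i)%N))); first over.
      by apply: leq_ltn_trans iN; rewrite leq_add2l ltnW.
    by move=> a s s' h; rewrite (depA i s s' h) h.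
  rewrite (mean_markov u0 procS statS markovS (Phi := fun s a => A i s * g a))//;
    last by move=> a s s' h; rewrite (depA i s s' h).
  rewrite -path_mean_sum -path_meanZ -2!path_meanD.
  rewrite -[RHS](mul0r (mean N (fun=> 0))) -path_meanZ.
  apply: eq_bigr => u _; congr (_ * _); set s := extend u0 u.
  have -> : \sum_(t < T) \sum_a st t a (s (T * i)%N) * (A i s * f t a (s (T * i)%N)) =
      A i s * F (s (T * i)%N).
    rewrite big_distrr/=; apply: eq_bigr => t _; rewrite big_distrr/=.
    by apply: eq_bigr => a _; rewrite mulrCA.
  have -> : \sum_a st T a (s (T * i)%N) * (A i s * g a) =
      A i s * \sum_a st T a (s (T * i)%N) * g a.
    by rewrite big_distrr/=; apply: eq_bigr => a _; rewrite mulrCA.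
  have := Hg (s (T * i)%N) => /eqP; rewrite subr_eq => /eqP ->; ring.
have A2 N i : (T * i < N)%N -> mean N (fun s => A i s ^+ 2) <= i%:R * KD.
  elim: i => [_|i IH].
    rewrite mul0r -[leRHS](path_mean_cst u0 P procS N 0) le_eqVlt; apply/orP; left.
    by apply/eqP/eq_bigr => u _; rewrite /A big_ord0 expr0n.
  rewrite mulnSr => iN.
  have m0 : (T * i < N)%N by apply: leq_ltn_trans iN; exact: leq_addr.
  have -> : mean N (fun s => A i.+1 s ^+ 2) =
      mean N (fun s => A i s ^+ 2 + (2 * (A i s * D i s) + D i s ^+ 2)).
    apply: eq_bigr => u _; congr (_ * _); rewrite /A big_ord_recr/=; ring.
  rewrite 2!path_meanD path_meanZ AD// mulr0 add0r -natr1 mulrDl mul1r.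
  apply: lerD; first exact: IH.
  rewrite -[leRHS](path_mean_cst u0 P procS N KD).
  by apply: (le_mean u0 procS statS m0) => s _.
(* From (x - y)^2 <= 2 x^2 + 2 y^2 with x the martingale and y the telescoped corrector, bounded by
   2 G. The constant 8 G^2 is absorbed in the linear bound since M >= 1 once M = 0 is set apart. *)
exists (2 * KD + 8 * G ^+ 2) => [|M].
  by rewrite addr_ge0// mulr_ge0// sqr_ge0.
have [->|M0] := posnP M.
  rewrite mulr0 -[leRHS](path_mean_cst u0 P procS (0 * T) 0) le_eqVlt; apply/orP; left.
  by apply/eqP/eq_bigr => u _; rewrite big_ord0 mul0r subrr expr0n.
(* The telescoped corrector involves the state at time T * M, one step beyond the block. *)
pose N := (T * M).+1.
rewrite -(path_mean_prefix u0 P procS (n := M * T) (N := N)); last 2 first.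
- by rewrite mulnC.
- move=> s s' h; congr ((_ - _) ^+ 2); apply: eq_bigr => i _; apply: eq_bigr => t _.
  have hh k : (k < T)%N -> s (T * i + k)%N = s' (T * i + k)%N.
    move=> kT; apply: h; rewrite [(M * T)%N]mulnC; apply: (@leq_trans (T * i.+1)).
      by rewrite mulnSr ltn_add2l.
    by rewrite leq_mul2l ltn_ord orbT.
  by have := hh 0%N T_gt0; rewrite addn0 hh// => ->.
apply: (@le_trans _ _ (mean N (fun s => 2 * A M s ^+ 2 + 8 * G ^+ 2))).
  apply: (@le_mean _ _ _ P _ u0 _ procS statS 0%N) => // s _.
  have -> : \sum_(i < M) \sum_(t < T) f t (s (T * i + t)%N) (s (T * i)%N) - M%:R * c
      = A M s - (g (s (T * M)%N) - g (s 0%N)).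
    elim: (M) => [|i IH]; first by rewrite /A !big_ord0 muln0 mul0r !subrr.
    have AS : A i.+1 s = A i s + D i s by rewrite /A big_ord_recr.
    rewrite AS big_ord_recr/= -natr1 /D mulnSr; lra.
  have h1 := gG (s (T * M)%N); have h2 := gG (s 0%N).
  set x := A M s; set y := _ - g (s 0%N).
  have y2 : y ^+ 2 <= (G + G) ^+ 2.
    rewrite -real_normK ?num_real// ler_sqr ?nnegrE ?addr_ge0//.
    by apply: (le_trans (ler_normB _ _)); exact: lerD.
  have := sqr_ge0 (x + y); nra.
rewrite path_meanD path_meanZ (path_mean_cst u0 P procS).
have := A2 N M (ltnSn _).
have : 1 <= M%:R :> R by rewrite ler1n.
have : 0 <= G ^+ 2 by exact: sqr_ge0.
nra.
Qed.

End PoissonEquation.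

(** * Converse *)

Section Converse.
Variable R : realType.

Lemma log2_1 : log2 (1 : R) = 0.
Proof. by rewrite /log2 ln1 mul0r. Qed.

Lemma log2_prod (I : finType) (z : I -> R) : (forall i, 0 < z i) ->
  log2 (\prod_i z i) = \sum_i log2 (z i).
Proof.
move=> z0; suff [] : 0 < \prod_i z i /\ log2 (\prod_i z i) = \sum_i log2 (z i) by [].
elim/big_ind2 : _ => [|x1 x2 y1 y2 [x0 hx] [y0 hy]|//]; first by rewrite log2_1.
by split; [exact: mulr_gt0|rewrite /log2 lnM ?posrE// mulrDl -hx -hy].
Qed.

Lemma channel_information_point_mass (X Y : finType) (x0 : X)
    (W : X -> Y -> R) : (forall x, \sum_y W x y = 1) ->
  channel_information (fun x => (x == x0)%:R) W = 0.
Proof.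
move=> W1; rewrite channel_information_pmf// big1// => x _; apply: big1 => y _.
have [->|_] := eqVneq; last by rewrite !mul0r.
rewrite (bigD1 x0)//= eqxx mul1r big1 ?addr0 => [|x' /negbTE ->]; last by rewrite mul0r.
have [->|w0] := eqVneq (W x0 y) 0; first by rewrite mul0r.
by rewrite divff// log2_1 mulr0.
Qed.

Lemma sum_blocks (M T : nat) (h : nat -> R) :
  \sum_(n < M * T) h n = \sum_(i < M) \sum_(t < T) h (T * i + t)%N.
Proof.
rewrite -(big_mkord xpredT h) big_nat_mul big_mkord.
apply: eq_bigr => i _; rewrite -{1}[(i * T)%N]add0n big_addn mulSn addnK big_mkord.
by apply: eq_bigr => t _; rewrite addnC mulnC.
Qed.

(** With the states fixed, the input is a function of the message; averages over messages thus
    become the information of the induced input law. *)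
Lemma channel_information_pushforward (A X Y : finType) (w : A -> R)
    (x : A -> X) (W : X -> Y -> R) : (forall x, \sum_y W x y = 1) ->
  channel_information (fun x' => \sum_a w a * (x' == x a)%:R) W =
  \sum_a w a * \sum_y W (x a) y * log2 (W (x a) y / \sum_a' w a' * W (x a') y).
Proof.
move=> W1; rewrite channel_information_pmf//.
have push (h : X -> R) :
    \sum_x' (\sum_a w a * (x' == x a)%:R) * h x' = \sum_a w a * h (x a).
  under eq_bigr do rewrite big_distrl/=.
  rewrite exchange_big; apply: eq_bigr => a _.
  rewrite (bigD1 (x a))//= eqxx mulr1 big1 ?addr0// => x' /negbTE ->.
  by rewrite mulr0 mul0r.
rewrite -(push (fun x' => \sum_y W x' y * log2 (W x' y / \sum_a' w a' * W (x a') y))).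
apply: eq_bigr => x' _; rewrite big_distrr/=; apply: eq_bigr => y _.
by rewrite (push (fun x' => W x' y)) mulrA.
Qed.

Section Code.
Context {d : measure_display} {Om : measurableType d}.
Variables (X Y U : finType) (p : X -> U -> Y -> R) (P : probability Om R).
Variables (S : nat -> Om -> U) (T : nat) (u0 : U).
Hypothesis p_pmf : forall x u, is_pmf (p x u).
Hypothesis procS : is_process S.
Hypothesis statS : stationary P S.
Hypothesis markovS : markov_process P S.

Let p_ge0 x u y : 0 <= p x u y.
Proof. by case: (p_pmf x u). Qed.

Let p_sum x u : \sum_y p x u y = 1.
Proof. by case: (p_pmf x u). Qed.

Section FixedCode.
Variables (M : nat) (c : Defs.code X Y U T M).
Hypothesis msg_gt0 : (0 < #|msg c|)%N.

Local Notation N := (M * T)%N.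
Local Notation L := (#|msg c|%:R : R).

Let L_gt0 : 0 < L. Proof. by rewrite ltr0n. Qed.

Let output_law (u : {ffun 'I_N -> U}) (n : 'I_N) (b : Y) : R :=
  \sum_m L^-1 * p (channel_input (c := c) m u n) (u n) b.

Let Lsum : \sum_(m : msg c) L^-1 = 1.
Proof. by rewrite sumr_const -[LHS]mulr_natl divff// gt_eqF. Qed.

Let output_law_ge0 u n b : 0 <= output_law u n b.
Proof. by apply: sumr_ge0 => m _; rewrite mulr_ge0// invr_ge0 ltW. Qed.

(** [divergence_success_bound] with reference [g], for a decoder that sees states and outputs. The
    log-ratio of the two product laws splits over time, and given message and states the n-th term
    depends on the n-th output only. *)
Lemma success_bound :
  (1 - error_probability p P S c) * log2 L <=
  1 + \sum_(n < N) \sum_u state_law P S u *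
    channel_information (fun x => \sum_m L^-1 * (x == channel_input (c := c) m u n)%:R)
      (fun x y => p x (u n) y).
Proof.
pose B := ({ffun 'I_N -> U} * {ffun 'I_N -> Y})%type.
pose J (m : msg c) (b : B) := joint_law p P S m b.1 b.2.
pose g (b : B) := state_law P S b.1 * \prod_n output_law b.1 n (b.2 n).
have law0 (u : {ffun 'I_N -> U}) := state_law_ge0 P S u.
have J0 m b : 0 <= J m b.
  by rewrite mulr_ge0 ?prodr_ge0// mulr_ge0// invr_ge0 ltW.
have J1 : \sum_m \sum_b J m b = 1.
  rewrite -[RHS]Lsum; apply: eq_bigr => m _.
  rewrite -(pair_bigA _ (fun u y => joint_law p P S m u y))/=.
  under eq_bigr do rewrite joint_law_msg_state//.
  by rewrite -big_distrr/= (state_law_sum u0)// mulr1.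
have g0 b : 0 <= g b by rewrite mulr_ge0// prodr_ge0.
have g1 : \sum_b g b = 1.
  rewrite -(pair_bigA _ (fun u (y : {ffun 'I_N -> Y}) =>
    state_law P S u * \prod_n output_law u n (y n)))/=.
  rewrite -[RHS](state_law_sum u0 P procS N); apply: eq_bigr => u _.
  rewrite -big_distrr/= -(bigA_distr_bigA (fun n b => output_law u n b)).
  rewrite big1 ?mulr1// => n _.
  rewrite exchange_big/= -[RHS]Lsum; apply: eq_bigr => m _.
  by rewrite -big_distrr/= p_sum mulr1.
have Jpos m b : 0 < J m b -> 0 < state_law P S b.1 /\
    forall n, 0 < p (channel_input (c := c) m b.1 n) (b.1 n) (b.2 n).
  move=> Jp; have /lt0r_neq0 := Jp.
  rewrite /J /joint_law mulf_eq0 negb_or mulf_eq0 negb_or.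
  move=> /andP[/andP[_ l0] /prodf_neq0 pn]; split=> [|n]; rewrite lt_neqAle eq_sym.
    by rewrite l0 law0.
  by rewrite pn// p_ge0.
have rpos m u n b : 0 < p (channel_input (c := c) m u n) (u n) b ->
    0 < output_law u n b.
  move=> pp; rewrite /output_law (bigD1 m)//= ltr_wpDr//.
    by apply: sumr_ge0 => m' _; rewrite mulr_ge0// invr_ge0 ltW.
  by rewrite mulr_gt0// invr_gt0.
have Jg m b : 0 < J m b -> 0 < g b.
  move=> /Jpos[l0 pn]; rewrite mulr_gt0//; apply: prodr_gt0 => n _.
  exact: rpos (pn n).
have := divergence_success_bound (fun b : B => dec c b.2 b.1) J0 J1 g0 g1 Jg.
have -> : \sum_m \sum_(b | dec c b.2 b.1 != m) J m b = error_probability p P S c.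
  apply: eq_bigr => m _; rewrite pair_big_dep/=.
  by apply: eq_bigl => -[u y].
move=> /le_trans; apply; rewrite lerD2l le_eqVlt; apply/orP; left; apply/eqP.
transitivity (\sum_m \sum_u \sum_(y : {ffun 'I_N -> Y}) L^-1 * state_law P S u *
   ((\prod_n p (channel_input (c := c) m u n) (u n) (y n)) *
    \sum_n log2 (p (channel_input (c := c) m u n) (u n) (y n) / output_law u n (y n)))).
  apply: eq_bigr => m _; rewrite pair_bigA/=; apply: eq_bigr => b _.
  rewrite [RHS]mulrA -[X in _ = X * _]/(J m b).
  have := J0 m b; rewrite le_eqVlt => /predU1P[<-|Jp]; first by rewrite !mul0r.
  have [l0 pn] := Jpos _ _ Jp; congr (_ * _).
  rewrite -log2_prod => [|n]; last by rewrite divr_gt0//; exact: rpos (pn n).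
  congr log2; rewrite /J /joint_law /g mulrA -mulf_div divff ?mul1r; last first.
    by rewrite mulf_neq0 ?gt_eqF// invr_gt0.
  by rewrite -prodfV -big_split.
rewrite exchange_big/= [RHS]exchange_big/=; apply: eq_bigr => u _.
transitivity (\sum_m \sum_n L^-1 * state_law P S u *
  \sum_b p (channel_input (c := c) m u n) (u n) b *
    log2 (p (channel_input (c := c) m u n) (u n) b / output_law u n b)).
  apply: eq_bigr => m _; rewrite -big_distrr/= -big_distrr/=; congr (_ * _).
  under eq_bigr do rewrite big_distrr/=.
  rewrite exchange_big/=; apply: eq_bigr => n _.
  exact: (sum_prod_ffun1 (w := fun n b => p (channel_input (c := c) m u n) (u n) b)
   (fun n => p_sum _ _) n
   (fun b => log2 (p (channel_input (c := c) m u n) (u n) b / output_law u n b))).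
rewrite exchange_big/=; apply: eq_bigr => n _.
rewrite channel_information_pushforward// big_distrr/=; apply: eq_bigr => m _.
by rewrite mulrA [state_law _ _ _ * _]mulrC.
Qed.

Lemma fed_back_extend (u : {ffun 'I_N -> U}) (n : 'I_N) j :
  fed_back u n j = extend u0 u (T * j)%N.
Proof. by rewrite ffunE (extend_lt _ _ (feedback_time_lt j)). Qed.

Variable Imax : nat -> U -> R.
Hypothesis ImaxP : forall (t : nat) v q, is_pmf q -> 0 < feedback_prob P S v ->
  averaged_information p P S t v q <= Imax t v.

(** The input law at time n is determined by the states up to time T * (n %/ T). Averaging over the
    state at time n by [mean_markov] thus gives an averaged information at lag n %% T, at most
    [Imax]; each of the M blocks contributes the same sum of bounds. *)
Lemma code_rate_bound :
  (1 - error_probability p P S c) * log2 L <=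
  1 + M%:R * \sum_(t < T) \sum_v feedback_prob P S v * Imax t v.
Proof.
apply: (le_trans success_bound); rewrite lerD2l.
apply: (@le_trans _ _ (\sum_(n < N) \sum_v feedback_prob P S v * Imax (n %% T)%N v)).
  apply: ler_sum => n _.
  pose inp (m : msg c) (s : nat -> U) : X :=
    enc (c := c) (n := n) m [ffun j : 'I_(n %/ T).+1 => s (T * j)%N].
  pose q s x : R := \sum_m L^-1 * (x == inp m s)%:R.
  pose Phi s a := channel_information (q s) (fun x y => p x a y).
  pose m := (T * (n %/ T))%N; pose k := (n %% T)%N.
  have nE : n = (m + k)%N :> nat by rewrite /m [(T * _)%N]mulnC -divn_eq.
  have mkN : (m + k < N)%N by rewrite -nE.
  have mN : (m < N)%N by apply: leq_ltn_trans mkN; exact: leq_addr.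
  have -> : \sum_u state_law P S u * channel_information
      (fun x => \sum_m L^-1 * (x == channel_input (c := c) m u n)%:R)
      (fun x y => p x (u n) y) = path_mean u0 P S N (fun s => Phi s (s (m + k)%N)).
    apply: eq_bigr => u _; congr (_ * _).
    rewrite /Phi -nE extend_ord; congr (channel_information _ _).
    apply/funext => x; apply: eq_bigr => m' _; congr (_ * (_ == _)%:R).
    congr enc; apply/ffunP => j; rewrite fed_back_extend ffunE//.
  rewrite (mean_markov u0 procS statS markovS)//; last first.
    move=> a s s' h; congr (channel_information _ _); apply/funext => x.
    apply: eq_bigr => m' _; congr (_ * (_ == _)%:R); congr enc; apply/ffunP => j.
    rewrite !ffunE; apply: h; rewrite ltnS leq_mul2l -ltnS ltn_ord orbT//.
  rewrite -(mean_at u0 procS statS (Imax k) mN).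
  apply: (@le_mean _ _ _ P _ u0 _ procS statS m) => // s pis.
  apply: ImaxP => //; split=> [x|].
    by apply: sumr_ge0 => m' _; rewrite mulr_ge0// invr_ge0 ltW.
  rewrite exchange_big/= -[RHS]Lsum; apply: eq_bigr => m' _.
  rewrite (bigD1 (inp m' s))//= eqxx mulr1 big1 ?addr0// => x /negbTE ->.
  by rewrite mulr0.
rewrite (sum_blocks M T (fun n => \sum_v feedback_prob P S v * Imax (n %% T)%N v)).
rewrite -[X in _ <= X%:R * _](card_ord M) mulr_natl -sumr_const.
rewrite le_eqVlt; apply/orP; left; apply/eqP; apply: eq_bigr => i _.
apply: eq_bigr => t _; apply: eq_bigr => v _.
by rewrite mulnC modnMDl modn_small.
Qed.

End FixedCode.
End Code.
End Converse.

(** * Achievability *)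

Section StrategyMarginal.
Variables (R : realType) (I V X : finType) (w : I -> V -> X -> R).
Hypothesis w1 : forall i v, \sum_x w i v x = 1.

(* Independent symbols are drawn for every pair (i, v); those met along v    *)
(* are again independent.                                                    *)
Lemma strategy_marginal (v : I -> V) (F : {ffun I -> X} -> R) :
  \sum_(a : {ffun I * V -> X}) (\prod_k w k.1 k.2 (a k)) *
    F [ffun i => a (i, v i)] =
  \sum_(x : {ffun I -> X}) (\prod_i w i (v i) (x i)) * F x.
Proof.
rewrite (partition_big (fun a : {ffun I * V -> X} => [ffun i => a (i, v i)]) xpredT)//=.
apply: eq_bigr => x _.
transitivity ((\sum_(a : {ffun I * V -> X} | [ffun i => a (i, v i)] == x)
    \prod_k w k.1 k.2 (a k)) * F x).
  by rewrite big_distrl/=; apply: eq_bigr => a /eqP <-.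
congr (_ * _).
pose G (k : I * V) : pred X := fun b => (k.2 == v k.1) ==> (b == x k.1).
have -> : \sum_(a : {ffun I * V -> X} | [ffun i => a (i, v i)] == x)
    \prod_k w k.1 k.2 (a k) = \prod_k \sum_(b | G k b) w k.1 k.2 b.
  rewrite bigA_distr_big_dep; apply: eq_bigl => a; apply/eqP/familyP.
    move=> e [i v'] /=; apply/implyP => /eqP/= ->.
    by rewrite -e ffunE.
  move=> h; apply/ffunP => i; rewrite ffunE.
  by have /implyP/(_ (eqxx _))/eqP := h (i, v i).
rewrite -(pair_bigA _ (fun i v' => \sum_(b | G (i, v') b) w i v' b))/=.
apply: eq_bigr => i _; rewrite (bigD1 (v i))//= [X in _ * X]big1 => [|v' /negbTE nv].
  by rewrite mulr1 /G/= eqxx/= big_pred1_eq.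
by rewrite /G/= nv/= w1.
Qed.

End StrategyMarginal.

Lemma sum_ffun_pair (R : realType) (I X Y : finType)
    (G : {ffun I -> X} -> {ffun I -> Y} -> R) :
  \sum_x \sum_y G x y =
  \sum_(b : {ffun I -> X * Y}) G [ffun i => (b i).1] [ffun i => (b i).2].
Proof.
rewrite pair_bigA/= (reindex (fun b : {ffun I -> X * Y} =>
  ([ffun i => (b i).1], [ffun i => (b i).2])))//=.
exists (fun xy : {ffun I -> X} * {ffun I -> Y} => [ffun i => (xy.1 i, xy.2 i)]).
  by move=> b _; apply/ffunP => i; rewrite !ffunE; case: (b i).
by move=> [x y] _; congr (_, _); apply/ffunP => i; rewrite !ffunE.
Qed.

Section Achievability.
Variable R : realType.
Context {d : measure_display} {Om : measurableType d}.
Variables (X Y U : finType) (p : X -> U -> Y -> R) (P : probability Om R).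
Variables (S : nat -> Om -> U) (T : nat) (u0 : U).
Hypothesis p_pmf : forall x u, is_pmf (p x u).
Hypothesis procS : is_process S.
Hypothesis statS : stationary P S.
Hypothesis markovS : markov_process P S.
Hypothesis T_gt0 : (0 < T)%N.
Hypothesis ergS : ergodic P (sampled_pair S T 0).
Variable q : nat -> U -> X -> R.
Hypothesis q_pmf : forall t v, is_pmf (q t v).

Let p_ge0 x u y : 0 <= p x u y. Proof. by case: (p_pmf x u). Qed.
Let p_sum x u : \sum_y p x u y = 1. Proof. by case: (p_pmf x u). Qed.
Let q_ge0 t v x : 0 <= q t v x. Proof. by case: (q_pmf t v). Qed.
Let q_sum t v : \sum_x q t v x = 1. Proof. by case: (q_pmf t v). Qed.

Let out t v a y := \sum_x q t v x * p x a y.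
Let dens t v a x y := log2 (p x a y / out t v a y).
Let info t a v := channel_information (q t v) (fun x y => p x a y).
Let cap := \sum_(t < T) \sum_v
  feedback_prob P S v * averaged_information p P S t v (q t v).

Let out_ge0 t v a y : 0 <= out t v a y.
Proof. by apply: sumr_ge0 => x _; exact: mulr_ge0. Qed.

Let out_gt0 t v a x y : 0 < q t v x -> 0 < p x a y -> 0 < out t v a y.
Proof.
move=> q0 p0; rewrite /out (bigD1 x)//= ltr_wpDr ?mulr_gt0//.
by apply: sumr_ge0 => x' _; exact: mulr_ge0.
Qed.

Let pair_law t v a (z : X * Y) := q t v z.1 * p z.1 a z.2.

Let pair_law_sum t v a : \sum_z pair_law t v a z = 1.
Proof.
rewrite -(pair_bigA _ (fun x y => q t v x * p x a y))/= -[RHS](q_sum t v).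
by apply: eq_bigr => x _; rewrite -big_distrr/= p_sum mulr1.
Qed.

Let infoE t a v : info t a v = \sum_z pair_law t v a z * dens t v a z.1 z.2.
Proof. by rewrite /info channel_information_pmf// pair_bigA. Qed.

Let var t v a := \sum_z pair_law t v a z * (dens t v a z.1 z.2 - info t a v) ^+ 2.

Let pair_law_ge0 t v a z : 0 <= pair_law t v a z.
Proof. exact: mulr_ge0. Qed.

Let var_ge0 t v a : 0 <= var t v a.
Proof. by apply: sumr_ge0 => z _; rewrite mulr_ge0// sqr_ge0. Qed.

Section Block.
Variable M : nat.
Local Notation N := (M * T)%N.

Let pos (n : 'I_N) := (n %% T)%N.
Let fb (u : {ffun 'I_N -> U}) (n : 'I_N) := extend u0 u (T * (n %/ T))%N.

(** The conditional law of inputs and outputs given the states, a product over time. [dev] is the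
    information density minus its conditional mean, which is [block_info]. *)
Let weight (u : {ffun 'I_N -> U}) (x : {ffun 'I_N -> X}) (y : {ffun 'I_N -> Y}) :=
  (\prod_n q (pos n) (fb u n) (x n)) * \prod_n p (x n) (u n) (y n).

Let dev u (x : {ffun 'I_N -> X}) (y : {ffun 'I_N -> Y}) :=
  \sum_n (dens (pos n) (fb u n) (u n) (x n) (y n) - info (pos n) (u n) (fb u n)).

Let weight_ge0 u x y : 0 <= weight u x y.
Proof. by rewrite mulr_ge0// prodr_ge0. Qed.

Let weight_sum u : \sum_x \sum_y weight u x y = 1.
Proof.
rewrite sum_ffun_pair.
transitivity (\sum_(b : {ffun 'I_N -> X * Y})
    \prod_n pair_law (pos n) (fb u n) (u n) (b n)).
  apply: eq_bigr => b _; rewrite /weight -big_split/=.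
  by apply: eq_bigr => n _; rewrite !ffunE.
rewrite -(bigA_distr_bigA (fun n z => pair_law (pos n) (fb u n) (u n) z)).
by rewrite big1.
Qed.

Let weight_variance u :
  \sum_x \sum_y weight u x y * dev u x y ^+ 2 =
  \sum_n var (pos n) (fb u n) (u n).
Proof.
rewrite sum_ffun_pair.
transitivity (\sum_(b : {ffun 'I_N -> X * Y})
    (\prod_n pair_law (pos n) (fb u n) (u n) (b n)) *
    (\sum_n (dens (pos n) (fb u n) (u n) (b n).1 (b n).2 -
             info (pos n) (u n) (fb u n))) ^+ 2).
  apply: eq_bigr => b _; rewrite /weight /dev -big_split/=; congr (_ * _ ^+ 2).
    by apply: eq_bigr => n _; rewrite !ffunE.
  by apply: eq_bigr => n _; rewrite !ffunE.
rewrite (variance_sum_prod_ffun (w := fun n => pair_law (pos n) (fb u n) (u n))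
  (fun n => pair_law_sum _ _ _) 
  (f := fun n (z : X * Y) => dens (pos n) (fb u n) (u n) z.1 z.2 -
                             info (pos n) (u n) (fb u n)))//.
move=> n; under eq_bigr do rewrite mulrBr.
by rewrite sumrB -infoE -big_distrl/= pair_law_sum mul1r subrr.
Qed.

Let block_info (u : {ffun 'I_N -> U}) := \sum_n info (pos n) (u n) (fb u n).

(** Chebyshev's inequality in pointwise form. On the atypical set the two deviations add up to at
    most -2 M delta, so their squares add up to at least 2 (M delta)^2 and the factor on the right
    is at least 1. *)
Let typical_bound (delta : R) (u : {ffun 'I_N -> U}) (x : {ffun 'I_N -> X})
    (y : {ffun 'I_N -> Y}) : (0 < M)%N -> 0 < delta ->
  \prod_n p (x n) (u n) (y n) <=
    expR ((M%:R * cap - 2 * (M%:R * delta)) * ln 2) *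
    \prod_n out (pos n) (fb u n) (u n) (y n) ->
  weight u x y <= weight u x y *
    ((dev u x y ^+ 2 + (block_info u - M%:R * cap) ^+ 2) / (2 * (M%:R * delta) ^+ 2)).
Proof.
move=> M0 delta0; set th := (_ - _); move=> le.
have := weight_ge0 u x y; rewrite le_eqVlt => /predU1P[<-|w0]; first by rewrite mul0r.
apply: ler_peMr; first exact: ltW.
have /lt0r_neq0 := w0; rewrite mulf_eq0 negb_or => /andP[/prodf_neq0 qn /prodf_neq0 pn].
have q0 n : 0 < q (pos n) (fb u n) (x n) by rewrite lt_neqAle eq_sym qn ?q_ge0.
have p0 n : 0 < p (x n) (u n) (y n) by rewrite lt_neqAle eq_sym pn ?p_ge0.
have o0 n : 0 < out (pos n) (fb u n) (u n) (y n) by exact: out_gt0 (q0 n) (p0 n).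
have Md : 0 < M%:R * delta by rewrite mulr_gt0// ltr0n.
have sum_le : \sum_n dens (pos n) (fb u n) (u n) (x n) (y n) <= th.
  rewrite /dens -log2_prod => [|n]; last exact: divr_gt0.
  rewrite big_split/= prodfV /log2 ler_pdivrMr ?ln2_gt0//.
  rewrite -(expRK (th * ln 2)) ler_ln ?posrE ?expR_gt0//.
    by rewrite ler_pdivrMr// prodr_gt0.
  by rewrite divr_gt0// prodr_gt0.
have devE : dev u x y + (block_info u - M%:R * cap) <= - (2 * (M%:R * delta)).
  rewrite /dev sumrB -/(block_info u) /block_info; move: sum_le; rewrite /th; lra.
rewrite ler_pdivlMr ?mul1r; last by rewrite mulr_gt0// exprn_gt0.
move: devE Md; set A := dev u x y; set B := _ - M%:R * cap; set D := M%:R * delta.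
move=> h D0; have : (2 * D) ^+ 2 <= (A + B) ^+ 2.
  by rewrite -(sqrrN (A + B)) ler_sqr ?nnegrE; lra.
have := sqr_ge0 (A - B); nra.
Qed.

(** The law of a random strategy. [Ws] is the channel from strategies to what the receiver sees,
    states included. *)
Let Qs (a : {ffun 'I_N * U -> X}) := \prod_k q (pos k.1) k.2 (a k).
Let inputs (u : {ffun 'I_N -> U}) (a : {ffun 'I_N * U -> X}) : {ffun 'I_N -> X} :=
  [ffun n => a (n, fb u n)].
Let Ws (a : {ffun 'I_N * U -> X}) (b : {ffun 'I_N -> U} * {ffun 'I_N -> Y}) :=
  state_law P S b.1 * \prod_n p (inputs b.1 a n) (b.1 n) (b.2 n).

Let Qs_pmf : is_pmf Qs.
Proof.
split=> [a|]; first exact: prodr_ge0.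
by rewrite -(bigA_distr_bigA (fun k x => q (pos k.1) k.2 x)) big1.
Qed.

Let Ws_pmf a : is_pmf (Ws a).
Proof.
split=> [b|]; first by rewrite mulr_ge0 ?prodr_ge0// (state_law_ge0 P S).
rewrite -(pair_bigA _ (fun u (y : {ffun 'I_N -> Y}) =>
    state_law P S u * \prod_n p (inputs u a n) (u n) (y n)))/=.
rewrite -[RHS](state_law_sum u0 P procS N); apply: eq_bigr => u _.
rewrite -big_distrr/= -(bigA_distr_bigA (fun n b => p (inputs u a n) (u n) b)).
by rewrite big1 ?mulr1.
Qed.

Let output_Ws (b : {ffun 'I_N -> U} * {ffun 'I_N -> Y}) :
  \sum_a Qs a * Ws a b =
  state_law P S b.1 * \prod_n out (pos n) (fb b.1 n) (b.1 n) (b.2 n).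
Proof.
transitivity (state_law P S b.1 *
    \sum_a Qs a * \prod_n p (inputs b.1 a n) (b.1 n) (b.2 n)).
  by rewrite big_distrr/=; apply: eq_bigr => a _; rewrite mulrCA.
congr (_ * _).
rewrite (strategy_marginal (w := fun n v x => q (pos n) v x) (fun n v => q_sum _ _)
  (fb b.1) (fun x => \prod_n p (x n) (b.1 n) (b.2 n))).
exact: (sum_prod_ffun (fun n x => q (pos n) (fb b.1 n) x)
  (fun n x => p x (b.1 n) (b.2 n))).
Qed.

(** For a fixed state path, [strategy_marginal] replaces the strategies by independent inputs; then
    [typical_bound] is summed, and [weight_variance] evaluates the first square. *)
Let atypical_mass (delta : R) : (0 < M)%N -> 0 < delta ->
  \sum_a \sum_(b | Ws a b <= expR ((M%:R * cap - 2 * (M%:R * delta)) * ln 2) *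
                    \sum_a' Qs a' * Ws a' b) Qs a * Ws a b <=
  (\sum_u state_law P S u * (\sum_n var (pos n) (fb u n) (u n) +
     (block_info u - M%:R * cap) ^+ 2)) / (2 * (M%:R * delta) ^+ 2).
Proof.
move=> M0 delta0; set gam := expR _.
pose bad u (x : {ffun 'I_N -> X}) (y : {ffun 'I_N -> Y}) :=
  state_law P S u * \prod_n p (x n) (u n) (y n) <=
  gam * (state_law P S u * \prod_n out (pos n) (fb u n) (u n) (y n)).
have -> : \sum_a \sum_(b | Ws a b <= gam * \sum_a' Qs a' * Ws a' b) Qs a * Ws a b =
  \sum_(u : {ffun 'I_N -> U}) \sum_(y : {ffun 'I_N -> Y})
    \sum_(x : {ffun 'I_N -> X}) (\prod_n q (pos n) (fb u n) (x n)) *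
    (if bad u x y then state_law P S u * \prod_n p (x n) (u n) (y n) else 0).
  under eq_bigr do under eq_bigl do rewrite output_Ws.
  under eq_bigr do rewrite big_mkcond/=.
  rewrite exchange_big/= -(pair_bigA _ (fun u y => \sum_a
    (if Ws a (u, y) <=
        gam * (state_law P S u * \prod_n out (pos n) (fb u n) (u n) (y n))
    then Qs a * Ws a (u, y) else 0)))/=.
  apply: eq_bigr => u _; apply: eq_bigr => y _.
  rewrite -(strategy_marginal (w := fun n v x => q (pos n) v x) (fun n v => q_sum _ _)
    (fb u) (fun x =>
      if bad u x y then state_law P S u * \prod_n p (x n) (u n) (y n) else 0)).
  apply: eq_bigr => a _; rewrite /bad /Ws/= -/(inputs u a).
  by case: ifP; rewrite ?mulr0.
rewrite big_distrl/=; apply: ler_sum => u _.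
have l0 := state_law_ge0 P S u.
apply: (@le_trans _ _ (\sum_x \sum_y state_law P S u * (weight u x y *
    ((dev u x y ^+ 2 + (block_info u - M%:R * cap) ^+ 2) /
     (2 * (M%:R * delta) ^+ 2))))).
  rewrite exchange_big/=; apply: ler_sum => x _; apply: ler_sum => y _.
  case: ifP => [|_]; last first.
    rewrite mulr0 mulr_ge0// mulr_ge0// divr_ge0 ?addr_ge0 ?sqr_ge0//.
    by rewrite mulr_ge0// sqr_ge0.
  rewrite /bad; have := l0; rewrite le_eqVlt => /predU1P[<-|lp].
    by move=> _; rewrite !mul0r mulr0.
  move=> h0; have h : \prod_n p (x n) (u n) (y n) <=
      gam * \prod_n out (pos n) (fb u n) (u n) (y n).
    by move: h0; rewrite [leRHS]mulrCA ler_pM2l.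
  by rewrite mulrCA ler_pM2l//; exact: typical_bound.
rewrite le_eqVlt; apply/orP; left; apply/eqP; rewrite -mulrA -weight_variance.
transitivity (state_law P S u * \sum_x \sum_y (weight u x y * dev u x y ^+ 2 +
    weight u x y * (block_info u - M%:R * cap) ^+ 2) / (2 * (M%:R * delta) ^+ 2)).
  rewrite [RHS]big_distrr/=; apply: eq_bigr => x _; rewrite [RHS]big_distrr/=.
  by apply: eq_bigr => y _; rewrite -mulrDr !mulrA.
congr (_ * _).
under eq_bigr do
  rewrite -big_distrl big_split/= -(big_distrl ((block_info u - _) ^+ 2)).
rewrite -big_distrl/= big_split/=; congr ((_ + _) / _).
by rewrite -big_distrl/= weight_sum mul1r.
Qed.

Let max_var := \sum_(t < T) \sum_v \sum_a var t v a.

Let var_le n v a : var (n %% T) v a <= max_var.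
Proof.
have sum_ge t : 0 <= \sum_v' \sum_a' var t v' a'.
  by apply: sumr_ge0 => v' _; exact: sumr_ge0.
rewrite /max_var (bigD1 (Ordinal (ltn_pmod n T_gt0)))//= (bigD1 v)//= (bigD1 a)//=.
rewrite -!addrA lerDl !addr_ge0 ?sumr_ge0// => v' _; exact: sumr_ge0.
Qed.

(** [feinstein] for [Ws] with threshold 2^(M cap - 2 M delta). Its bound holds for every message,
    hence for their average. *)
Lemma random_block_code (K delta : R) (L : nat) :
  (0 < M)%N -> (0 < L)%N -> 0 < delta ->
  \sum_u state_law P S u * (block_info u - M%:R * cap) ^+ 2 <= K * M%:R ->
  exists c : Defs.code X Y U T M, #|msg c| = L /\
    error_probability p P S c <=
    (T%:R * max_var + K) / (2 * delta ^+ 2) / M%:R +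
    L%:R / expR ((M%:R * cap - 2 * (M%:R * delta)) * ln 2).
Proof.
case: L => // L M0 _ delta0 HK; set gam := expR _.
have gam0 : 0 < gam by exact: expR_gt0.
have M0R : 0 < M%:R :> R by rewrite ltr0n.
have [a [dec0 Hdec]] := feinstein Qs_pmf Ws_pmf L.+1 gam0.
pose c := @Code X Y U T M 'I_L.+1
  (fun n m w => a m (n, w ord_max)) (fun y u => inord (dec0 (u, y))).
exists c.
rewrite card_ord; split=> //.
set eps := \sum_a0 _ + _ in Hdec.
apply: (@le_trans _ _ eps).
  rewrite /error_probability/=.
  have -> : eps = \sum_(m < L.+1) L.+1%:R^-1 * eps.
    by rewrite sumr_const card_ord -[RHS]mulr_natl mulrA divff ?mul1r// pnatr_eq0.
  apply: ler_sum => m _.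
  apply: (@le_trans _ _ (L.+1%:R^-1 * \sum_(b | dec0 b != m) Ws (a m) b)).
    rewrite pair_big_dep/= big_distrr/= big_mkcond [leRHS]big_mkcond/=.
    apply: ler_sum => -[u y] _ /=.
    have W0 : 0 <= L.+1%:R^-1 * Ws (a m) (u, y).
      by rewrite mulr_ge0 ?invr_ge0//; case: (Ws_pmf (a m)).
    have -> : joint_law p P S (c := c) m u y = L.+1%:R^-1 * Ws (a m) (u, y).
      rewrite /joint_law /= card_ord -mulrA; congr (_ * (_ * _)).
      apply: eq_bigr => n _; congr (p _ _ _).
      by rewrite /channel_input/= (fed_back_extend u0) [RHS]ffunE.
    case: ifP => h1; case: ifP => h2 //.
    by move: h1; rewrite (eqP (negbFE h2)) inord_val eqxx.
  by rewrite ler_pM2l ?invr_gt0 ?ltr0n//; exact: Hdec.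
rewrite /eps lerD2r; apply: (le_trans (atypical_mass M0 delta0)).
have -> : (T%:R * max_var + K) / (2 * delta ^+ 2) / M%:R =
    ((M * T)%:R * max_var + K * M%:R) / (2 * (M%:R * delta) ^+ 2).
  by rewrite natrM; field; rewrite !gt_eqF.
rewrite ler_pM2r; last by rewrite invr_gt0 mulr_gt0// exprn_gt0// mulr_gt0.
under eq_bigr do rewrite mulrDr.
rewrite big_split/=; apply: lerD => //.
rewrite -[leRHS]mul1r -[X in _ <= X * _](state_law_sum u0 P procS N) big_distrl/=.
apply: ler_sum => u _; apply: ler_wpM2l; first exact: (state_law_ge0 P S).
rewrite -[X in X%:R * _](card_ord N) mulr_natl -sumr_const.
by apply: ler_sum => n _; exact: var_le.
Qed.

End Block.

Lemma exists_good_code (delta : R) : 0 < delta ->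
  exists K, forall M L, (0 < M)%N -> (0 < L)%N ->
    exists c : Defs.code X Y U T M, #|msg c| = L /\
      error_probability p P S c <=
      K / M%:R + L%:R / expR ((M%:R * cap - 2 * (M%:R * delta)) * ln 2).
Proof.
move=> delta0.
have [K _ HK] := block_sum_second_moment u0 procS statS markovS T_gt0 ergS info.
exists ((T%:R * (\sum_(t < T) \sum_v \sum_a var t v a) + K) /
        (2 * delta ^+ 2)) => M L M0 L0.
apply: random_block_code => //; apply: le_trans (HK M).
rewrite le_eqVlt; apply/orP; left; apply/eqP; apply: eq_bigr => u _.
congr (_ * (_ - _ * _) ^+ 2).
  pose h n := info (n %% T) (extend u0 u n) (extend u0 u (T * (n %/ T))%N).
  transitivity (\sum_(n < M * T) h n).
    by apply: eq_bigr => n _; rewrite /h extend_ord.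
  rewrite sum_blocks; apply: eq_bigr => i _; apply: eq_bigr => t _.
  rewrite /h [(T * i)%N]mulnC modnMDl divnMDl// modn_small// divn_small//.
  by rewrite addn0 [(T * i)%N]mulnC.
rewrite /cap exchange_big/=; apply: eq_bigr => v _; rewrite big_distrr/=.
by apply: eq_bigr => t _.
Qed.

End Achievability.

(** * Capacity *)

Section Capacity.
Local Open Scope classical_set_scope.
Variable R : realType.
Context {d : measure_display} {Om : measurableType d}.
Variables (X Y U : finType) (p : X -> U -> Y -> R) (P : probability Om R).
Variables (S : nat -> Om -> U) (T : nat).

Lemma probability_inhabited : exists w : Om, True.
Proof.
apply: contrapT => n; have := @probability_setT _ _ _ P.
rewrite (_ : [set: Om] = set0) ?measure0.
  by move=> /eqP; rewrite eqe eq_sym oner_eq0.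
by rewrite -subset0 => w _; apply: n; exists w.
Qed.

Definition single_message_code (x0 : X) M : Defs.code X Y U T M :=
  @Code X Y U T M unit (fun _ _ _ => x0) (fun _ _ => tt).

Lemma rate_single_message_code x0 M : rate (single_message_code x0 M) = 0 :> R.
Proof. by rewrite /rate/= card_unit log2_1 mul0r. Qed.

Lemma error_single_message_code x0 M :
  error_probability p P S (single_message_code x0 M) = 0.
Proof.
rewrite /error_probability big1// => -[] _; rewrite big1// => u _.
by rewrite big_pred0.
Qed.

Lemma achievable_le0 (x0 : X) r : r <= 0 -> achievable p P S T r.
Proof.
move=> r0; exists (single_message_code x0), (fun=> 0); split.
- exact: cvg_cst.
- by move=> M _; rewrite rate_single_message_code subr0.
- under eq_fun do rewrite error_single_message_code.
  exact: cvg_cst.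
Qed.

Lemma error_probability_ge0 M (c : Defs.code X Y U T M) :
  (forall x u, is_pmf (p x u)) -> 0 <= error_probability p P S c.
Proof.
move=> pp; do 3!apply: sumr_ge0 => ? _.
rewrite mulr_ge0 ?mulr_ge0 ?invr_ge0// ?(state_law_ge0 P S)//.
by apply: prodr_ge0 => n _; exact: (pp _ _).1.
Qed.

Lemma cvg_to0_harmonic_bound (e : nat -> R) K :
  (forall M, (0 < M)%N -> 0 <= e M <= K / M%:R) -> e @ \oo --> 0.
Proof.
move=> eK; rewrite -cvg_shiftS /=.
apply: (@squeeze_cvgr _ _ _ _ (fun=> 0) (fun n => K * harmonic n)).
- by near=> n; exact: eK.
- exact: cvg_cst.
- by rewrite -[X in _ --> X](mulr0 K); apply: cvgMl_tmp; exact: cvg_harmonic.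
Unshelve. all: by end_near. Qed.

Hypothesis p_pmf : forall x u, is_pmf (p x u).
Hypothesis procS : is_process S.
Hypothesis statS : stationary P S.
Hypothesis markovS : markov_process P S.
Hypothesis T_gt0 : (0 < T)%N.

(** [code_rate_bound] divided by M * T: the additive bit becomes 1 / (M T), and it vanishes in the
    limit together with the error and the rate loss. *)
Lemma achievable_le (Imax : nat -> U -> R) r :
  (forall t v q, is_pmf q -> 0 < feedback_prob P S v ->
     averaged_information p P S t v q <= Imax t v) ->
  0 <= \sum_(t < T) \sum_v feedback_prob P S v * Imax t v ->
  achievable p P S T r ->
  r <= T%:R^-1 * \sum_(t < T) \sum_v feedback_prob P S v * Imax t v.
Proof.
move=> ImaxP; set cap := \sum_(t < T) _ => cap0 [c [eps [eps0 rate_ge err0]]].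
have [w _] := probability_inhabited; pose u0 := S 0%N w.
have T0 : 0 < T%:R :> R by rewrite ltr0n.
pose err M := error_probability p P S (c M).
have bound M : (0 < M)%N -> 0 <= 1 - err M ->
    (1 - err M) * (r - eps M) <= T%:R^-1 * cap + T%:R^-1 * M%:R^-1.
  move=> M0 e1; apply: (le_trans (ler_wpM2l e1 (rate_ge M M0))).
  have MT0 : 0 < (M * T)%:R :> R by rewrite ltr0n muln_gt0 M0.
  have M0R : 0 < M%:R :> R by rewrite ltr0n.
  rewrite /rate mulrA ler_pdivrMr//.
  have -> : (T%:R^-1 * cap + T%:R^-1 / M%:R) * (M * T)%:R = 1 + M%:R * cap.
    by rewrite natrM; field; rewrite !gt_eqF.
  have [L0|L0] := posnP #|msg (c M)|; last first.
    exact: (code_rate_bound u0 p_pmf procS statS markovS L0 ImaxP).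
  (* An empty message set has rate 0, since ln 0 = 0. *)
  by rewrite L0 /log2 ln0// mul0r mulr0 addr_ge0// mulr_ge0// ltW.
have err1 : \forall M \near \oo, 0 <= 1 - err M.
  near=> M; rewrite subr_ge0 ltW//; near: M.
  exact: (cvgr_lt _ err0).
have cvgL : (fun M => (1 - err M) * (r - eps M)) @ \oo --> r.
  have h1 : (fun M => 1 - err M) @ \oo --> (1 - 0 : R).
    by apply: cvgB => //; exact: cvg_cst.
  have h2 : (fun M => r - eps M) @ \oo --> (r - 0 : R).
    by apply: cvgB => //; exact: cvg_cst.
  by have := cvgM h1 h2; rewrite !subr0 mul1r; apply.
have cvgR : (fun M : nat => T%:R^-1 * cap + T%:R^-1 * M%:R^-1) @ \oo --> T%:R^-1 * cap.
  have h : (fun M : nat => T%:R^-1 * M%:R^-1 : R) @ \oo --> (0 : R).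
    apply: (@cvg_to0_harmonic_bound _ T%:R^-1) => M M0.
    by rewrite lexx mulr_ge0 ?invr_ge0.
  by have := cvgD (cvg_cst (T%:R^-1 * cap)) h; rewrite addr0; apply.
apply: (ler_cvg_to cvgL cvgR); near=> M; apply: bound.
  by near: M; exists 1%N.
by near: M.
Unshelve. all: by end_near. Qed.

Hypothesis ergS : ergodic P (sampled_pair S T 0).

Lemma lt_achievable (x0 : X) (q : nat -> U -> X -> R) r :
  (forall t v, is_pmf (q t v)) ->
  r < T%:R^-1 * \sum_(t < T) \sum_v feedback_prob P S v *
    averaged_information p P S t v (q t v) ->
  achievable p P S T r.
Proof.
move=> q_pmf; set cap := \sum_(t < T) _ => rC.
have [r0|r0] := leP r 0; first exact: achievable_le0.
have [w _] := probability_inhabited; pose u0 := S 0%N w.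
have T0 : 0 < T%:R :> R by rewrite ltr0n.
have l2 := ln2_gt0 R.
(* A third of the gap: M cap - 2 M delta - M T r = M delta, so about 2^(M T r) messages stay M delta
   bits below the threshold. *)
pose delta := (cap - T%:R * r) / 3.
have delta0 : 0 < delta.
  by rewrite divr_gt0// subr_gt0; move: rC; rewrite mulrC ltr_pdivlMr// mulrC.
have [K HK] := exists_good_code u0 p_pmf procS statS markovS T_gt0 ergS q_pmf delta0.
(* This is 2^(M T r). Taking one message more than its integer part makes the rate at least r with
   no loss, and at most doubles the count since r > 0. *)
pose E M := expR ((M * T)%:R * r * ln 2).
have [c Hc] : exists c : forall M, Defs.code X Y U T M, forall M, (0 < M)%N ->
    #|msg (c M)| = (Num.truncn (E M)).+1 /\
    error_probability p P S (c M) <= K / M%:R + (Num.truncn (E M)).+1%:R /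
      expR ((M%:R * cap - 2 * (M%:R * delta)) * ln 2).
  have Hex M : exists c : Defs.code X Y U T M, (0 < M)%N ->
      #|msg c| = (Num.truncn (E M)).+1 /\
      error_probability p P S c <= K / M%:R + (Num.truncn (E M)).+1%:R /
      expR ((M%:R * cap - 2 * (M%:R * delta)) * ln 2).
    have [->|M0] := posnP M; first by exists (single_message_code x0 0).
    by have [c Hc] := HK M (Num.truncn (E M)).+1 M0 isT; exists c.
  by exists (fun M => sval (cid (Hex M))) => M; exact: (svalP (cid (Hex M))).
exists c, (fun=> 0); split; first exact: cvg_cst.
  move=> M M0; have [Lc _] := Hc M M0.
  rewrite subr0 /rate Lc ler_pdivlMr; last by rewrite ltr0n muln_gt0 M0.
  rewrite /log2 ler_pdivlMr// [r * _]mulrC -(expRK (_ * ln 2)).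
  by rewrite ler_ln ?posrE ?expR_gt0 ?ltr0Sn// ltW// truncnS_gt.
apply: (@cvg_to0_harmonic_bound _ (K + 2 / (delta * ln 2))) => M M0.
have [_ err_le] := Hc M M0; rewrite error_probability_ge0//=.
apply: (le_trans err_le); rewrite [leRHS]mulrDl lerD2l.
have M0R : 0 < M%:R :> R by rewrite ltr0n.
have E1 : 1 <= E M by rewrite -expR0 ler_expR !mulr_ge0// ltW.
apply: (@le_trans _ _ (2 * E M / expR ((M%:R * cap - 2 * (M%:R * delta)) * ln 2))).
  rewrite ler_pM2r ?invr_gt0 ?expR_gt0// -natr1 mulr_natl mulr2n lerD//.
  by rewrite truncn_le expR_ge0.
rewrite -mulrA -expRN -expRD -[leRHS]mulrA ler_pM2l// -invfM.
have -> : (M * T)%:R * r * ln 2 - (M%:R * cap - 2 * (M%:R * delta)) * ln 2 =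
    - (delta * ln 2 * M%:R) by rewrite natrM /delta; field.
set z := delta * ln 2 * M%:R.
have z0 : 0 < z by exact: mulr_gt0 (mulr_gt0 delta0 l2) M0R.
(* The exponential decay is weakened to 1 / z by z <= 1 + z <= exp z, to match the Chebyshev term of
   order 1 / M. *)
rewrite expRN lef_pV2 ?posrE ?expR_gt0//.
by apply: le_trans (expR_ge1Dx z); rewrite lerDr.
Qed.

End Capacity.

Theorem theorem1 (R : realType) (X Y U : finType) (T : nat)
    (d : measure_display) (Om : measurableType d) (P : probability Om R)
    (S : nat -> Om -> U) (p : X -> U -> Y -> R) :
  (0 < #|X|)%N ->
  (0 < T)%N ->
  (forall x u, is_pmf (p x u)) ->
  is_process S ->
  markov_process P S ->
  stationary P S ->
  (forall t : 'I_T,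
     stationary P (sampled_pair S T t) /\ ergodic P (sampled_pair S T t)) ->
  exists q : 'I_T -> U -> X -> R,
    (forall (t : 'I_T) (v : U), 0 < feedback_prob P S v ->
       is_pmf (q t v) /\
       (forall q' : X -> R, is_pmf q' ->
          averaged_information p P S t v q' <=
          averaged_information p P S t v (q t v))) /\
    capacity p P S T =
    (T%:R^-1 * \sum_(t < T) \sum_(v : U | 0 < feedback_prob P S v)
       feedback_prob P S v * averaged_information p P S t v (q t v))%:E.
Proof.
move=> X0 T0 p_pmf procS markovS statS ergS.
have /card_gt0P[x0 _] := X0.
have {}ergS : ergodic P (sampled_pair S T 0) := (ergS (Ordinal T0)).2.
have /choice[q0 q0P] : forall tv : nat * U, exists q : X -> R, is_pmf q /\
    forall q', is_pmf q' -> averaged_information p P S tv.1 tv.2 q' <=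
                            averaged_information p P S tv.1 tv.2 q.
  by move=> [t v]; exact: exists_max_information.
pose q t v := q0 (t, v).
have q_pmf t v : is_pmf (q t v) := (q0P (t, v)).1.
have q_max t v := (q0P (t, v)).2.
exists (fun t v => q t v); split=> [t v _|]; first by split; [|exact: q_max].
pose Imax t v := averaged_information p P S t v (q t v).
have -> : \sum_(t < T) \sum_(v : U | 0 < feedback_prob P S v)
    feedback_prob P S v * averaged_information p P S t v (q t v) =
    \sum_(t < T) \sum_v feedback_prob P S v * Imax t v.
  apply: eq_bigr => t _; rewrite big_mkcond/=; apply: eq_bigr => v _.
  case: ltP => // pv; suff -> : feedback_prob P S v = 0 by rewrite mul0r.
  by apply/le_anti; rewrite pv feedback_prob_ge0.
have ImaxP t v q' : is_pmf q' -> 0 < feedback_prob P S v ->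
  averaged_information p P S t v q' <= Imax t v by move=> + _; exact: q_max.
(* A deterministic input carries no information, so the maximum is nonnegative. [achievable_le] uses
   this for codes with an empty message set. *)
have Imax0 t v : 0 <= Imax t v.
  have x0_pmf : is_pmf (fun x : X => (x == x0)%:R : R).
    split=> //; rewrite (bigD1 x0)//= eqxx big1 ?addr0// => x /negbTE ->//.
  apply: le_trans (q_max t v _ x0_pmf); apply: sumr_ge0 => u _.
  by rewrite channel_information_point_mass ?mulr0// => x; exact: (p_pmf x u).2.
apply/eqP; rewrite eq_le; apply/andP; split.
  apply: ge_ereal_sup => _ [r rP <-]; rewrite lee_fin.
  apply: achievable_le rP => //; do 2!apply: sumr_ge0 => ? _.
  by rewrite mulr_ge0// feedback_prob_ge0.
(* The value itself need not be shown achievable: every rate below it by some e > 0 is, which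
   suffices for the supremum. *)
apply/lee_subgt0Pr => e e0; apply: ereal_sup_ubound; rewrite -EFinB.
apply: (imageP (fun r : R => r%:E)).
apply: (lt_achievable p_pmf procS statS markovS T0 ergS x0 q_pmf).
by rewrite ltrBlDr ltrDl.
Qed.
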